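(* There exist positive constants $c_1$ and $c_2$ such that for all sufficiently large $n$, $$c_1\frac{n^{3/4}}{(\log n)^{3/2}}<f_{6,3}(n)-\pi(n)<c_2\frac{n^{3/4}}{(\log n)^{3/2}}.$$
   Context: $\log$ is the natural logarithm and $\pi(n)$ is the number of primes not exceeding $n$. $f_{k,d}(n)$ is the maximal size of a set $A\subseteq\{1,\dots,n\}$ such that the equation $a_1a_2\cdots a_k=x^d$ (with $a_1,\dots,a_k\in A$ not necessarily distinct, $x$ an integer) has no solution except trivial ones, where a solution is trivial if the multiset $\{a_1,\dots,a_k\}$ can be partitioned into $d$-element sub-multisets each consisting of $d$ copies of the same number. *)

(* Defs.v *)
From mathcomp Require Import all_boot all_order all_algebra.
From mathcomp Require Import boolp.

Set Implicit Arguments.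
Unset Strict Implicit.
Unset Printing Implicit Defensive.

Import GRing.Theory.

Definition prime_count (n : nat) : nat := count prime (iota 1 n).

(* The multiset is encoded as a sequence up to permutation; each block
   [nseq d x] consists of d copies of the same number, and distinct blocks may
   carry the same number. *)
Definition trivial_solution (d : nat) (a : seq nat) : Prop :=
  exists b : seq nat, perm_eq a (flatten [seq nseq d x | x <- b]).

(* The ordinals 'I_n.+1 are 0, ..., n, so that excluding ord0 leaves the subsets
   of {1, ..., n}. *)
Definition only_trivial_solutions (k d n : nat) (A : {set 'I_n.+1}) : Prop :=
  ord0 \notin A /\
  forall (a : k.-tuple 'I_n.+1) (x : int),
    (forall i : 'I_k, tnth a i \in A) ->
    ((\prod_(i < k) (tnth a i : nat))%N%:Z = x ^+ d)%R ->
    trivial_solution d (map val a).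

(* For k > 0 the empty set is admissible, so the maximum is over a nonempty
   family. *)
Definition f_max (k d n : nat) : nat :=
  \max_(A : {set 'I_n.+1} | `[< only_trivial_solutions k d A >]) #|A|.

(* Main.v *)
Require Import Defs.
From mathcomp Require Import all_boot all_order all_algebra.
From mathcomp Require Import all_field.
From mathcomp Require Import boolp.
From mathcomp Require Import zify lra ring.

(** Both bounds come from C4-free bipartite graphs whose edges are the numbers
    [u * v].

    Upper bound: if [a * b = c * d] then [a, b, c, c, d, d] multiplies to
    [(c * d) ^ 3], so [A] is a multiplicative Sidon set. With [n <= 2 ^ (24 K)] and
    [Q = 2 ^ (16 K)], the elements having a prime factor [p > Q] number at most
    [pi(n) + Q], by the Kovari-Sos-Turan bound between primes and cofactors. Any other
    element is written [m = u * v] with [u] the largest divisor of [m] up to [Q]. As long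
    as [u / v] is at most a small power of [n], maximality of [u] makes [v] free of prime
    factors up to [2 ^ K], and makes the part of [u] composed of such primes at most
    [u / v].
    Chebyshev's bounds then show that both [u] and [v] are scarcer by a factor about
    [log n] than integers of their size, and Kovari-Sos-Turan in each block
    [u ~ 16 ^ (b + j)], [v ~ 16 ^ b] gives a sum dominated by [u ~ v ~ sqrt n], up to
    a convergent series in [j].

    Lower bound: label the points and the lines of an affine plane over a field
    with [2 ^ l] elements by distinct primes up to [sqrt n], and take the products
    (point * line) over the incidences, together with all primes above [2 ^ k ~ sqrt n].
    In a product of six elements equal to a cube the multiplicities of the edges,
    read modulo 3, vanish: otherwise some C4 would appear, since each vertex met has
    degree at least 3 (with multiplicity) while there are at most six edges. *)

Set Implicit Arguments.
Unset Strict Implicit.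
Unset Printing Implicit Defensive.

Import Order.TTheory GRing.Theory Num.Theory.

(** * Chebyshev's bounds *)

Lemma prod_primes_dvd (s : seq nat) (x : nat) :
  uniq s -> all prime s -> all (dvdn^~ x) s -> \prod_(p <- s) p %| x.
Proof.
elim: s => [|p s IHs] /=; first by rewrite big_nil dvd1n.
case/andP=> ps us /andP[pp ap] /andP[px ax].
rewrite big_cons Gauss_dvd ?px ?IHs //.
rewrite big_seq; elim/big_ind: _ => [|x1 x2 c1 c2|q qs]; first exact: coprimen1.
  by rewrite coprimeMr c1.
rewrite prime_coprime // dvdn_prime2 ?(allP ap q) //.
by apply/eqP => epq; move: ps; rewrite epq qs.
Qed.

Lemma bin_double_le (m : nat) : 'C(m.*2, m) <= 2 ^ m.*2.
Proof.
rewrite -[2]/(1 + 1) expnDn (bigD1 (inord m)) //= inordK ?ltnS -?addnn ?leq_addr //.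
by rewrite !exp1n !muln1 leq_addr.
Qed.

(** By Pascal's rule the next central coefficient is a sum of two equal terms, each at least the
    current one. *)
Lemma bin_double_ge (m : nat) : 2 ^ m <= 'C(m.*2, m).
Proof.
elim: m => // m IHm; rewrite expnS doubleS.
have := mul_bin_diag m.*2.+1 m; rewrite /= => e1.
have e2 := binS m.*2 m.
have := mul_bin_left m.*2 m. rewrite -addnn addnK addnn => e3.
have e4 := binS m.*2.+1 m.
have := bin_sub (n := m.*2.+1) (m := m); rewrite -[in _ - _]addnn => /(_ ltac:(lia)).
rewrite (_ : (m + m).+1 - m = m.+1); last lia.
move=> e5. rewrite e4 e5.
have : 'C(m.*2, m) <= 'C(m.*2.+1, m) by case: (m) => // k; rewrite binS leq_addr.
lia.
Qed.

Lemma prime_dvd_fact (p n : nat) : prime p -> (p %| n`!) = (p <= n).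
Proof.
move=> pp; elim: n => [|n IHn].
  by rewrite fact0 dvdn1 leqn0; case: p pp => [|[|]].
rewrite factS Euclid_dvdM // IHn.
apply/orP/idP => [[/dvdn_leq->//|/leqW//]|].
by rewrite leq_eqVlt ltnS => /predU1P[->|->]; [left|right].
Qed.

Lemma prime_countD (m k : nat) :
  prime_count (m + k) = prime_count m + count prime (iota m.+1 k).
Proof. by rewrite /prime_count iotaD count_cat add1n. Qed.

Lemma leq_prime_count (m n : nat) : m <= n -> prime_count m <= prime_count n.
Proof. by move=> /subnKC <-; rewrite prime_countD leq_addr. Qed.

(** Every prime in (m, 2m] divides (2m)! but not m!, hence divides the central coefficient, and so
    does the product of these primes. *)
Lemma prime_count_double (m : nat) :
  m ^ count prime (iota m.+1 m) <= 'C(m.*2, m).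
Proof.
have C0 : 0 < 'C(m.*2, m) by rewrite bin_gt0 -addnn leq_addr.
pose s := [seq p <- iota m.+1 m | prime p].
have sP p : p \in s -> [/\ prime p, m < p & p <= m.*2].
  by rewrite mem_filter mem_iota => /and3P[-> *]; split; lia.
have: \prod_(p <- s) p %| 'C(m.*2, m).
  apply: prod_primes_dvd; first by rewrite filter_uniq ?iota_uniq.
    by apply/allP => p /sP[].
  apply/allP => p /sP[pp mp p2m].
  have := bin_fact (n := m.*2) (m := m); rewrite -[in _ - _]addnn addnK => /(_ ltac:(lia)) e.
  have: p %| m.*2`! by rewrite prime_dvd_fact.
  rewrite -e !Euclid_dvdM // prime_dvd_fact // orbb leqNgt mp orbF //.
move/(dvdn_leq C0); apply: leq_trans.
rewrite -size_filter -/s.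
have: all (leq m) s by apply/allP => p /sP[_ /ltnW].
elim: (s) => [|p t IHt] /=; first by rewrite big_nil.
by case/andP=> mp /IHt; rewrite big_cons expnS; apply: leq_mul.
Qed.

Lemma prime_count_dyadic (i : nat) :
  i * count prime (iota (2 ^ i).+1 (2 ^ i)) <= 2 * 2 ^ i.
Proof.
have := leq_trans (prime_count_double (2 ^ i)) (bin_double_le _).
by rewrite -expnM leq_exp2l // mul2n.
Qed.

Lemma chebyshev_upper (i : nat) : i * prime_count (2 ^ i) <= 6 * 2 ^ i.
Proof.
elim: i => // i IHi.
case: i IHi => [//|[//|i] IHi].
set k := i.+2 in IHi *.
have e : prime_count (2 ^ k.+1) = prime_count (2 ^ k) + count prime (iota (2 ^ k).+1 (2 ^ k)).
  by rewrite -prime_countD expnS mul2n addnn.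
have := prime_count_dyadic k.
rewrite e expnS.
(* The constant 6 closes the induction: [(k + 1) / k <= 3 / 2] and [3 / 2 * (6 + 2) = 2 * 6]. *)
have k2 : 2 <= k by [].
nia.
Qed.

(** In Legendre's formula the term floor(2m / p^k) - 2 floor(m / p^k) is at most 1, and it vanishes
    once p^k > 2m. *)
Lemma logn_bin_double (p m : nat) : prime p -> 0 < m ->
  logn p 'C(m.*2, m) <= trunc_log p m.*2.
Proof.
move=> pp m0; have p1 := prime_gt1 pp.
have C0 : 0 < 'C(m.*2, m) by rewrite bin_gt0 -addnn leq_addr.
have := bin_fact (n := m.*2) (m := m); rewrite -[in _ - _]addnn addnK => /(_ ltac:(lia)) e.
have := congr1 (logn p) e.
rewrite !lognM ?muln_gt0 ?fact_gt0 // !logn_fact //.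
set L := logn _ _.
have -> : \sum_(1 <= k < m.+1) m %/ p ^ k = \sum_(1 <= k < m.*2.+1) m %/ p ^ k.
  rewrite [RHS](@big_cat_nat _ _ _ m.+1) //=; last lia.
  rewrite [X in _ = _ + X]big1_seq ?addn0 // => k /andP[_]; rewrite mem_index_iota => /andP[mk _].
  by rewrite divn_small // (leq_trans mk) // ltnW // ltn_expl.
move=> eL.
have: \sum_(1 <= k < m.*2.+1) m.*2 %/ p ^ k <=
  (\sum_(1 <= k < m.*2.+1) m %/ p ^ k + \sum_(1 <= k < m.*2.+1) m %/ p ^ k) +
  \sum_(1 <= k < m.*2.+1) (p ^ k <= m.*2).
  rewrite -!big_split /=; apply: leq_sum => k _.
  have pk : 0 < p ^ k by rewrite expn_gt0 prime_gt0.
  case: (leqP (p ^ k) m.*2) => h; last by rewrite divn_small.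
  suff : m.*2 %/ p ^ k < (m %/ p ^ k + m %/ p ^ k) + 2 by rewrite addn2 addn1 ltnS.
  rewrite ltn_divLR //.
  have := ltn_ceil m pk; nia.
rewrite -eL => h.
have {h} : L <= \sum_(1 <= k < m.*2.+1) (p ^ k <= m.*2) by lia.
move/leq_trans; apply.
set T := trunc_log _ _.
have T2 : T <= m.*2.
  have := trunc_logP p1 (n := m.*2) ltac:(lia). have := ltn_expl T p1. rewrite -/T; lia.
rewrite (@big_cat_nat _ _ _ T.+1) //=.
rewrite [X in _ + X]big1_seq ?addn0; last first.
  move=> k /andP[_]; rewrite mem_index_iota => /andP[Tk _].
  apply/eqP; rewrite eqb0 -ltnNge (leq_trans (trunc_log_ltn m.*2 p1)) // leq_exp2l //.
rewrite [leqRHS](_ : T = \sum_(1 <= k < T.+1) 1); last by rewrite sum_nat_const_nat muln1 subn1.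
by apply: leq_sum => k _; case: (p ^ k <= m.*2).
Qed.

(** Each prime power in the factorization of the coefficient is at most 2m, and so are the primes
    themselves. *)
Lemma bin_double_le_prime_count (m : nat) : 0 < m ->
  'C(m.*2, m) <= m.*2 ^ prime_count m.*2.
Proof.
move=> m0.
have C0 : 0 < 'C(m.*2, m) by rewrite bin_gt0 -addnn leq_addr.
rewrite {1}(prod_prime_decomp C0) prime_decompE big_map /=.
have pM p : p \in primes 'C(m.*2, m) -> prime p && (p <= m.*2).
  rewrite mem_primes => /and3P[pp _ pd]; rewrite pp /=.
  rewrite -prime_dvd_fact //.
  have := bin_fact (n := m.*2) (m := m); rewrite -[in _ - _]addnn addnK => /(_ ltac:(lia)) <-.
  exact: dvdn_mulr.
apply: leq_trans (_ : m.*2 ^ size (primes 'C(m.*2, m)) <= _).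
  have: all (fun p => prime p) (primes 'C(m.*2, m)).
    by apply/allP => p /pM/andP[].
  elim: (primes _) => [|p s IHs] /=; first by rewrite big_nil.
  case/andP=> pp ps; rewrite big_cons expnS leq_mul ?IHs //.
  apply: leq_trans (trunc_logP (prime_gt1 pp) _); last lia.
  by rewrite leq_exp2l ?prime_gt1 // logn_bin_double.
rewrite leq_exp2l; last lia.
rewrite /prime_count -size_filter; apply: uniq_leq_size; first exact: primes_uniq.
move=> p /pM/andP[pp pm]; rewrite mem_filter pp mem_iota prime_gt0 //=; lia.
Qed.

Lemma chebyshev_lower (i : nat) : 2 ^ i <= i.+1 * prime_count (2 ^ i.+1).
Proof.
have := leq_trans (bin_double_ge (2 ^ i)) (bin_double_le_prime_count _).
rewrite expn_gt0 => /(_ isT).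
by rewrite -mul2n -expnS -expnM leq_exp2l.
Qed.

(** * Integers without small prime factors *)

(** Excluding 1 guarantees a least prime factor, on which the recursion for [roughs] rests. *)
Definition rough (z x : nat) : bool := (1 < x) && all (ltn z) (primes x).

Definition roughs (z X : nat) : seq nat := [seq x <- iota 1 X | rough z x].

Lemma roughP (z x : nat) :
  reflect (1 < x /\ forall p, prime p -> p %| x -> z < p) (rough z x).
Proof.
apply: (iffP andP) => [[x1 /allP h]|[x1 h]]; split => //.
  by move=> p pp px; apply: h; rewrite mem_primes pp px ltnW.
by apply/allP => p; rewrite mem_primes => /and3P[pp _]; apply: h.
Qed.

Lemma mem_roughs (z X x : nat) : (x \in roughs z X) = rough z x && (x <= X).
Proof.
rewrite mem_filter mem_iota add1n ltnS; apply: andb_id2l => /andP[x1 _].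
by rewrite (ltnW x1).
Qed.

(** A rough number is a prime, or its least prime factor times a rough cofactor. *)
Lemma size_roughs_le (z X : nat) :
  size (roughs z X) <= count (fun p => prime p && (z < p)) (iota 1 X) +
    \sum_(p <- iota 1 X | prime p && (z < p)) size (roughs z (X %/ p)).
Proof.
pose P := [seq p <- iota 1 X | prime p && (z < p)].
rewrite -size_filter -big_filter -/P.
have -> : \sum_(p <- P) size (roughs z (X %/ p)) =
    size (flatten [seq [seq p * y | y <- roughs z (X %/ p)] | p <- P]).
  elim: P => [|p P IHP] /=; first by rewrite big_nil.
  by rewrite big_cons size_cat size_map IHP.
rewrite -size_cat; apply: uniq_leq_size; first by rewrite filter_uniq ?iota_uniq.
move=> x; rewrite mem_roughs => /andP[/roughP[x1 h] xX].
have pp := pdiv_prime x1; have pd := pdiv_dvd x.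
have PP : pdiv x \in P.
  rewrite mem_filter pp h //= mem_iota prime_gt0 //= add1n ltnS.
  by rewrite (leq_trans (dvdn_leq (ltnW x1) pd)).
rewrite mem_cat; have [px|npx] := boolP (prime x).
  by rewrite mem_filter px h //= mem_iota add1n ltnS xX ltnW.
apply/orP; right; apply/flattenP; exists [seq pdiv x * y | y <- roughs z (X %/ pdiv x)].
  by apply/mapP; exists (pdiv x).
apply/mapP; exists (x %/ pdiv x); last by rewrite mulnC divnK.
have y0 : 0 < x %/ pdiv x by rewrite divn_gt0 ?prime_gt0 // dvdn_leq // ltnW.
rewrite mem_roughs leq_div2r // andbT; apply/roughP; split.
  rewrite ltn_neqAle y0 andbT; apply/eqP => e; move: npx.
  by rewrite -(divnK pd) -e mul1n pp.
by move=> p p_pr /dvdn_trans pv; apply: h => //; apply: pv; rewrite -[X in _ %| X](divnK pd) dvdn_mulr.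
Qed.

Lemma prime_count_le (K X : nat) : 2 ^ K <= X -> K * prime_count X <= 12 * X.
Proof.
move=> KX; have X0 : 0 < X by apply: leq_trans KX; rewrite expn_gt0.
have [h1 h2] := andP (trunc_log_bounds (p := 2) isT X0).
have h3 := trunc_log_max (p := 2) isT KX.
move: h1 h2 h3; set i := trunc_log 2 X => h1 h2 h3.
have := chebyshev_upper i.+1; rewrite expnS => h4.
have := leq_prime_count (ltnW h2); rewrite expnS => h5.
nia.
Qed.

Section RoughCount.
Variable R : realFieldType.
Local Open Scope ring_scope.

(** By Chebyshev each dyadic interval (2^i, 2^(i+1)] with i >= K contributes at most 2 / i <= 2 /
    K. *)
Lemma sum_inv_primes_dyadic (K d : nat) : (0 < K)%N ->
  \sum_(p <- iota 1 (2 ^ (K + d)) | prime p && (2 ^ K < p)%N) (p%:R^-1 : R)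
    <= 2 * d%:R / K%:R.
Proof.
move=> K0; have K0' : 0 < K%:R :> R by rewrite ltr0n.
elim: d => [|d IHd].
  rewrite addn0 mulr0 mul0r big1_seq // => p /andP[/andP[_ Kp]].
  by rewrite mem_iota add1n ltnS [(p <= _)%N]leqNgt Kp andbF.
rewrite addnS expnS mul2n -addnn iotaD big_cat /= add1n.
rewrite -[d.+1]addn1 natrD mulrDr mulrDl mulr1; apply: lerD => //.
set i := (K + d)%N.
apply: le_trans (_ : \sum_(p <- iota (2 ^ i).+1 (2 ^ i) | prime p) ((2 ^ i)%:R^-1 : R) <= _).
  rewrite big_seq_cond [leRHS]big_seq_cond.
  rewrite [leRHS](bigID (fun p => 2 ^ K < p)%N) /=.
  under eq_bigl do rewrite andbA.
  apply: ler_wpDr; first by apply: sumr_ge0 => p _; rewrite invr_ge0.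
  apply: ler_sum => p /andP[/andP[]]; rewrite mem_iota => /andP[ip _] _ _.
  have p0 : (0 < p)%N := leq_ltn_trans (leq0n _) ip.
  by rewrite lef_pV2 ?posrE ?ltr0n ?expn_gt0 // ler_nat ltnW.
rewrite big_const_seq iter_addr_0 -[_ *+ _]mulr_natr.
have i0 : 0 < (2 ^ i)%:R :> R by rewrite ltr0n expn_gt0.
rewrite mulrC ler_pdivrMr // mulrAC ler_pdivlMr // -!natrM ler_nat.
apply: leq_trans (prime_count_dyadic i).
by rewrite mulnC leq_mul2r leq_addr orbT.
Qed.

Lemma sum_inv_primes (K X : nat) : (0 < K)%N -> (X <= 2 ^ (17 * K))%N ->
  \sum_(p <- iota 1 X | prime p && (2 ^ K < p)%N) (p%:R^-1 : R) <= 32.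
Proof.
move=> K0 X17; have := sum_inv_primes_dyadic (16 * K) K0.
rewrite natrM mulrA mulfK ?pnatr_eq0 -?lt0n // -mulSn -(subnKC X17) iotaD big_cat /=.
rewrite -natrM => h.
by apply: le_trans h; rewrite lerDl sumr_ge0 // => p _; rewrite invr_ge0.
Qed.

(** An elementary substitute for a sieve: dividing by a prime above [2 ^ K] lowers [k] by one. In
    the recursion for the constant, 12 accounts for the primes and 32 bounds the sum of their
    inverses, which needs [X <= 2 ^ (17 * K)]. *)
Lemma size_roughs_le_induct (K k X : nat) : (0 < K)%N -> (k <= 17)%N -> (X < 2 ^ (k * K))%N ->
  (size (roughs (2 ^ K) X))%:R <= iter k (fun D => 12 + 32 * D) 0 * X%:R / K%:R :> R.
Proof.
move=> K0; have K0' : 0 < K%:R :> R by rewrite ltr0n.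
elim: k X => [|k IHk] X k17 Xk.
  by move: Xk; rewrite mul0n expn0 ltnS leqn0 => /eqP->; rewrite /= mul0r mul0r.
set D := iter k _ _ in IHk *; rewrite iterS -/D.
have D0 : 0 <= D by rewrite /D; elim: (k) => //= m h; rewrite addr_ge0 ?mulr_ge0.
have := size_roughs_le (2 ^ K) X; rewrite -(ler_nat R) natrD => /le_trans; apply.
rewrite mulrDl mulrDl; apply: lerD.
  rewrite ler_pdivlMr // -natrM -natrM ler_nat mulnC.
  have [KX|XK] := leqP (2 ^ K) X.
    apply: leq_trans (prime_count_le KX); rewrite leq_mul2l; apply/orP; right.
    by apply: sub_count => p /andP[].
  rewrite (_ : count _ _ = 0%N) ?muln0 //; apply/eqP; rewrite -leqn0 leqNgt -has_count.
  apply/hasPn => p; rewrite mem_iota add1n ltnS => /andP[_ pX].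
  by rewrite negb_and -leqNgt (leq_trans pX (ltnW XK)) orbT.
rewrite natr_sum.
apply: le_trans (_ : \sum_(p <- iota 1 X | prime p && (2 ^ K < p)%N)
    D * X%:R / K%:R * p%:R^-1 <= _).
  apply: ler_sum => p /andP[pp Kp].
  apply: le_trans (IHk _ _ _) _; [lia| |].
    rewrite ltn_divLR ?prime_gt0 //; apply: leq_trans Xk _.
    by rewrite mulSn expnD mulnC leq_mul2l ltnW ?orbT.
  have p0 : 0 < p%:R :> R by rewrite ltr0n prime_gt0.
  rewrite -!mulrA ler_wpM2l // [_ / p%:R]mulrC mulrA ler_wpM2r ?invr_ge0 //.
  by rewrite ler_pdivlMr // -natrM ler_nat leq_trunc_div.
rewrite -mulr_sumr mulrC -!mulrA ler_wpM2r ?mulr_ge0 ?invr_ge0 // sum_inv_primes //.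
by apply: ltnW; apply: leq_trans Xk _; rewrite leq_exp2l // leq_mul2r k17 orbT.
Qed.

Lemma size_roughs_bound : exists2 D : R, 1 <= D &
  forall K X : nat, (0 < K)%N -> (X < 2 ^ (17 * K))%N ->
    (size (roughs (2 ^ K) X))%:R <= D * X%:R / K%:R.
Proof.
exists (iter 17 (fun D => 12 + 32 * D) 0); last by move=> K X K0; apply: size_roughs_le_induct.
have D0 m : 0 <= iter m (fun D => 12 + 32 * D) (0 : R).
  by elim: m => //= m h; rewrite addr_ge0 ?mulr_ge0.
by rewrite iterS; have := D0 16%N; lra.
Qed.

End RoughCount.

(** * Largest divisors and the Kovari-Sos-Turan bound *)

Definition largest_divisor (Q m : nat) : nat := \max_(d <- divisors m | d <= Q) d.

Lemma largest_divisor_max (Q m d : nat) :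
  0 < m -> d %| m -> d <= Q -> d <= largest_divisor Q m.
Proof.
by move=> m0 dm dQ; apply: (@leq_bigmax_seq _ _ _ (fun d => d)); rewrite -?dvdn_divisors.
Qed.

Lemma largest_divisorP (Q m : nat) : 0 < m -> 0 < Q ->
  [/\ 0 < largest_divisor Q m, largest_divisor Q m %| m & largest_divisor Q m <= Q].
Proof.
move=> m0 Q0; have u0 := largest_divisor_max m0 (dvd1n m) Q0.
suff : (largest_divisor Q m == 0) ||
    (largest_divisor Q m %| m) && (largest_divisor Q m <= Q).
  by rewrite eqn0Ngt u0 => /andP[].
rewrite /largest_divisor big_seq_cond.
elim/big_ind: _ => // [x y hx hy|d /andP[]]; first by case: (leqP x y).
by rewrite -dvdn_divisors // => -> ->; rewrite orbT.
Qed.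

(** By maximality of u it is enough that v <= h^2, which is clear when u >= h. If u < h, a prime p
    dividing v would yield a larger admissible divisor: p * u when p <= h, and p itself
    otherwise. *)
Lemma largest_codivisor_le (h m : nat) : 0 < m -> m <= h ^ 3 ->
    (forall p, prime p -> p %| m -> p <= h ^ 2) ->
  m %/ largest_divisor (h ^ 2) m <= largest_divisor (h ^ 2) m.
Proof.
move=> m0 mh smooth; have h0 : 0 < h by case: (h) mh m0 => //; rewrite exp0n; lia.
have Q0 : 0 < h ^ 2 by rewrite expn_gt0 h0.
have [u0 um uQ] := largest_divisorP m0 Q0.
set u := largest_divisor _ _ in u0 um uQ *.
have umax d : d %| m -> d <= h ^ 2 -> d <= u by apply: largest_divisor_max.
apply: (umax); first by apply/dvdnP; exists u; rewrite mulnC divnK.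
have [hu|uh] := leqP h u.
  rewrite leq_divLR //; apply: leq_trans mh _.
  by rewrite expnS mulnC leq_mul2l hu orbT.
have [->//|v1] := eqVneq (m %/ u) 1.
have v0 : 0 < m %/ u by rewrite divn_gt0 // dvdn_leq.
have v2 : 1 < m %/ u by rewrite ltn_neqAle eq_sym v1.
set p := pdiv (m %/ u); have pp : prime p := pdiv_prime v2.
have pv : p %| m %/ u := pdiv_dvd _.
have p1 := prime_gt1 pp.
have pm : p %| m by apply: dvdn_trans pv _; apply/dvdnP; exists u; rewrite mulnC divnK.
have pum : p * u %| m by rewrite -[m](divnK um) dvdn_mul.
have [hp|ph] := leqP p h.
  have : p * u <= h ^ 2 by rewrite -mulnn leq_mul // ltnW.
  by move/(umax _ pum); rewrite -[X in _ <= X]mul1n leq_mul2r; lia.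
by have := umax p pm (smooth p pp pm); lia.
Qed.

Lemma codivisor_prime_lt (Q m p : nat) : 0 < m -> 0 < Q -> prime p ->
  p %| m %/ largest_divisor Q m -> Q < p * largest_divisor Q m.
Proof.
move=> m0 Q0 pp pv; have [u0 um uQ] := largest_divisorP m0 Q0.
rewrite ltnNge; apply/negP => /(largest_divisor_max m0) h.
have : p * largest_divisor Q m <= largest_divisor Q m.
  by apply: h; rewrite -[X in _ %| X](divnK um) dvdn_mul.
by rewrite -[X in _ <= X]mul1n leq_mul2r; have := prime_gt1 pp; lia.
Qed.

(* Exchanging the factors [d] of [u] and [1] of [v]: were [v * d] larger than [u],
   it would be a larger admissible divisor. Adding primes one by one, [v * d] can
   never jump over the gap between [u] and [Q]. *)
Lemma smooth_divisor_le (Q m z d : nat) : 0 < m -> 0 < Q ->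
    let u := largest_divisor Q m in let v := m %/ u in
    v <= u -> u * z <= Q ->
    d %| u -> (forall p, prime p -> p %| d -> p <= z) -> d * v <= u.
Proof.
move=> m0 Q0; have [u0 um uQ] := largest_divisorP m0 Q0.
move=> u v vu uz; elim/ltn_ind: d => d IHd du smooth.
have d0 : 0 < d := dvdn_gt0 u0 du.
have [->|d1] := eqVneq d 1; first by rewrite mul1n.
have d2 : 1 < d by rewrite ltn_neqAle eq_sym d1.
have pp := pdiv_prime d2; have pd := pdiv_dvd d.
have e := divnK pd; set p := pdiv d in pp pd e *; set d' := d %/ p in e *.
have d'd : d' %| d by rewrite -e dvdn_mulr.
have d'u : d' * v <= u.
  apply: IHd; first by rewrite /d' ltn_Pdiv // prime_gt1.
    exact: dvdn_trans du.
  by move=> q qp /dvdn_trans qd; apply: smooth => //; apply: qd.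
apply: largest_divisor_max => //; first by rewrite -(divnK um) mulnC dvdn_mul.
apply: leq_trans uz; rewrite -e mulnAC leq_mul // smooth //.
Qed.

Section KovariSosTuran.
Variable R : realFieldType.
Local Open Scope ring_scope.

(* The parameter [t] linearizes the usual bound: [d <= t + d * (d - 1) / t] for
   every natural number [d] and every real [t >= 1]. *)
Lemma kovari_sos_turan (T : finType) (A : {set T}) (f g : T -> nat) (U V : seq nat) (t : R) :
    uniq U -> {in A, forall a, f a \in U} -> {in A, forall a, g a \in V} ->
    {in A & A, forall a b, f a = f b -> g a = g b -> a = b} ->
    (forall a b c d, a \in A -> b \in A -> c \in A -> d \in A -> a != b ->
      f a = f b -> f c = f d -> g a = g c -> g b = g d -> a = c) ->
    1 <= t ->
  #|A|%:R <= t * (size U)%:R + (size V)%:R ^+ 2 / t.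
Proof.
move=> uU fU gV inj C4 t1; have t0 : 0 < t by apply: lt_le_trans t1.
pose d x := (\sum_(a in A) (f a == x))%N.
have pick1 a (F : nat -> nat) : a \in A -> (\sum_(x <- U) (f a == x) * F x = F (f a))%N.
  move=> aA; rewrite (bigD1_seq (f a)) ?fU //= eqxx mul1n big1 ?addn0 // => x.
  by rewrite eq_sym => /negbTE->.
have sd : (\sum_(x <- U) d x = #|A|)%N.
  rewrite exchange_big -sum1_card; apply: eq_bigr => a aA.
  by rewrite -[RHS](pick1 a (fun=> 1%N) aA); apply: eq_bigr => x _; rewrite muln1.
(* Ordered pairs of distinct edges with a common end in [U]. *)
pose P := [set p : T * T | [&& p.1 \in A, p.2 \in A, p.1 != p.2 & f p.1 == f p.2]].
have sd2 : (\sum_(x <- U) d x * d x = #|A| + #|P|)%N.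
  under eq_bigr do rewrite big_distrlr /=.
  rewrite exchange_big -[#|A|]sum1_card -[#|P|]sum1_card /=.
  have -> : (\sum_(p in P) 1 = \sum_(a in A) \sum_(b in A | (a != b) && (f a == f b)) 1)%N.
    by rewrite pair_big_dep /=; apply: eq_bigl => -[a b]; rewrite !inE.
  rewrite -big_split /=; apply: eq_bigr => a aA.
  rewrite exchange_big /= (bigD1 a) //= (pick1 a (fun x => (f a == x) : nat)) // eqxx.
  congr (_ + _)%N; rewrite big_mkcondr /= [RHS]big_mkcondr /=; apply: eq_bigr => b bA.
  rewrite (pick1 a (fun x => (f b == x) : nat)) // [f b == _]eq_sym [b == a]eq_sym.
  by case: (a != b) => //=; case: (f a == f b).
(* In the absence of a C4 the two ends in [V] determine such a pair. *)
have leP : (#|P| <= size V * size V)%N.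
  rewrite cardE -(size_map (fun p => (g p.1, g p.2))) -(size_allpairs pair).
  apply: uniq_leq_size.
    rewrite map_inj_in_uniq ?enum_uniq // => -[a b] [c e].
    rewrite !mem_enum !inE /= => /and4P[aA bA ab /eqP fab] /and4P[cA eA ce /eqP fce] [gac gbe].
    have ac := C4 a b c e aA bA cA eA ab fab fce gac gbe.
    by subst c; rewrite (inj b e) // -fab.
  move=> q /mapP[[a b]]; rewrite mem_enum !inE /= => /and4P[aA bA _ _] ->.
  by apply/allpairsP; exists (g a, g b); rewrite /= !gV.
have key x : 0 <= (d x)%:R ^+ 2 - (d x)%:R - t * (d x)%:R + t ^+ 2 :> R.
  have h1 : 0 <= (3 * t + 1) * (t - 1) by apply: mulr_ge0; lra.
  have h2 := sqr_ge0 ((d x)%:R - (1 + t) / 2).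
  rewrite [X in 0 <= X](_ : _ = ((d x)%:R - (1 + t) / 2) ^+ 2 + (3 * t + 1) * (t - 1) / 4); last by field.
  by lra.
have : 0 <= \sum_(x <- U) ((d x)%:R ^+ 2 - (d x)%:R - t * (d x)%:R + t ^+ 2 : R).
  by apply: sumr_ge0.
rewrite !big_split /= sumrN -mulr_sumr big_const_seq iter_addr_0 count_predT -mulr_natr.
under eq_bigr do rewrite -natrX -mulnn.
rewrite sumrN -mulr_sumr -!natr_sum sd sd2 natrD => h.
move: leP; rewrite -(ler_nat R) natrM => leP.
rewrite -(ler_pM2l t0) mulrDr [t * (_ / t)]mulrC divfK ?gt_eqF //.
nra.
Qed.

End KovariSosTuran.

(** * Multiplicative Sidon sets: bounds in one block *)

(** As 0 is excluded, [a = c] or [a = d] already identifies the two pairs, by cancellation. *)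
Definition mult_sidon (n : nat) (A : {set 'I_n.+1}) : Prop :=
  ord0 \notin A /\
  forall a b c d : 'I_n.+1, a \in A -> b \in A -> c \in A -> d \in A ->
    a * b = c * d -> a = c \/ a = d.

Lemma mult_sidon_gt0 (n : nat) (A : {set 'I_n.+1}) (m : 'I_n.+1) :
  mult_sidon A -> m \in A -> 0 < m.
Proof.
case=> A0 _ mA; rewrite lt0n; apply/negP => /eqP m0.
by move: A0; rewrite (_ : ord0 = m) ?mA //; apply: val_inj.
Qed.

Lemma count_trivial_solution (d : nat) (s : seq nat) (x : nat) :
  trivial_solution d s -> d %| count_mem x s.
Proof.
case=> b /permP->; elim: b => [|y b IHb] /=; first exact: dvdn0.
by rewrite count_cat dvdn_addr // count_nseq dvdn_mull.
Qed.

Lemma only_trivial_solutions_sidon (n : nat) (A : {set 'I_n.+1}) :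
  only_trivial_solutions 6 3 A -> mult_sidon A.
Proof.
case=> A0 H; split=> // a b c d aA bA cA dA e.
have := H [tuple a; b; c; c; d; d] (Posz (c * d)).
case=> [i||bs p].
- rewrite (tnth_nth ord0); case: i => i /=.
  by do 6?[case: i => [//|i]].
- rewrite !exprS expr0 mulr1 -!PoszM; congr Posz.
  rewrite !big_ord_recl big_ord0 !(tnth_nth ord0) /=.
  by rewrite mulnA e; ring.
(* If [a] differs from [c] and [d], its multiplicity is 1 or 2, according to whether [b = a], and
   never a multiple of 3. *)
have /count_trivial_solution - /(_ (a : nat)) : trivial_solution 3 (map val [tuple a; b; c; c; d; d]) by exists bs.
rewrite /= eqxx.
have [/val_inj ->|ac] := eqVneq (c : nat) a; first by left.
have [/val_inj ->|ad] := eqVneq (d : nat) a; first by right.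
by case: eqVneq.
Qed.

Section Upper.
Variable R : rcfType.
Local Open Scope ring_scope.

(** Each number is read as an edge joining its factors [f a] and [g a]; the edges of a C4 would
    satisfy [a * d = b * c]. *)
Lemma sidon_kovari_sos_turan (n : nat) (A B : {set 'I_n.+1}) (f g : nat -> nat)
    (U V : seq nat) (t : R) :
    mult_sidon A -> B \subset A -> uniq U ->
    {in B, forall a : 'I_n.+1, [/\ (f a * g a)%N = a, f a \in U & g a \in V]} ->
    1 <= t ->
  #|B|%:R <= t * (size U)%:R + (size V)%:R ^+ 2 / t.
Proof.
move=> [_ S] /subsetP BA uU H t1.
apply: (@kovari_sos_turan R _ B (fun a => f a) (fun a => g a)) => //.
- by move=> a /H[].
- by move=> a /H[].
- move=> a b /H[ea _ _] /H[eb _ _] fab gab; apply: val_inj.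
  by rewrite /= -ea -eb fab gab.
move=> a b c d aB bB cB dB ab fab fcd gac gbd.
case: (S a d b c); rewrite ?BA //.
  case: (H a aB) (H b bB) (H c cB) (H d dB) => [ea _ _] [eb _ _] [ec _ _] [ed _ _].
  by rewrite -ea -eb -ec -ed fab fcd gac gbd; ring.
by move=> eab; rewrite eab eqxx in ab.
Qed.

Lemma sidon_large_prime (n K : nat) (A : {set 'I_n.+1}) :
    mult_sidon A -> (n <= 2 ^ (24 * K))%N ->
  #|[set m in A | 2 ^ (16 * K) < max_pdiv m]%N|%:R
    <= (prime_count n)%:R + 2 ^+ (16 * K) :> R.
Proof.
move=> SA nK.
pose f m := max_pdiv m; pose g m := (m %/ max_pdiv m)%N.
(* The cofactors lie below [2 ^ (8 * K)], and the choice [t = 1] keeps the coefficient of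
   [prime_count n] equal to 1. *)
have -> : (2 : R) ^+ (16 * K) = (size (iota 0 (2 ^ (8 * K))))%:R ^+ 2 / 1.
  by rewrite divr1 size_iota natrX -exprM; congr (_ ^+ _); lia.
rewrite /prime_count -size_filter -[X in _ <= X + _]mul1r.
apply: (@sidon_kovari_sos_turan _ A _ f g) => //.
- by apply/subsetP => m; rewrite inE => /andP[].
- by rewrite filter_uniq ?iota_uniq.
move=> m; rewrite inE => /andP[mA big].
have m0 := mult_sidon_gt0 SA mA.
have m1 : (1 < m)%N.
  case: (ltngtP 1 (m : nat)) big => // [|<-]; first by lia.
  by move/leq_trans => /(_ 1%N isT); rewrite ltnNge expn_gt0.
have mn : (m <= n)%N by rewrite -ltnS.
have pp := max_pdiv_prime m1; have pd := max_pdiv_dvd m.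
split; first by rewrite mulnC divnK.
  rewrite mem_filter pp mem_iota prime_gt0 //= add1n ltnS.
  by rewrite (leq_trans _ mn) // dvdn_leq.
rewrite mem_iota /= add0n ltn_divLR ?prime_gt0 //.
apply: leq_ltn_trans (leq_trans mn nK) _.
have -> : (24 * K = 8 * K + 16 * K)%N by lia.
by rewrite expnD ltn_mul2l expn_gt0 big.
Qed.

Lemma sum_inv_le (k : nat) : \sum_(s <- iota 1 (16 ^ k)) (s%:R^-1 : R) <= 1 + 15 * k%:R.
Proof.
elim: k => [|k IHk]; first by rewrite /= big_seq1 mulr0 addr0 invr1.
rewrite expnS (_ : (16 * 16 ^ k = 16 ^ k + 15 * 16 ^ k)%N); last by lia.
rewrite iotaD big_cat /= -[k.+1]addn1 natrD mulrDr addrA lerD // add1n.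
apply: le_trans (_ : \sum_(s <- iota (16 ^ k).+1 (15 * 16 ^ k)) ((16 ^ k)%:R^-1 : R) <= _).
  rewrite big_seq [leRHS]big_seq; apply: ler_sum => s; rewrite mem_iota => /andP[ks _].
  have s0 : (0 < s)%N := leq_ltn_trans (leq0n _) ks.
  by rewrite lef_pV2 ?posrE ?ltr0n ?expn_gt0 // ler_nat ltnW.
rewrite big_const_seq iter_addr_0 count_predT size_iota -[_ *+ _]mulr_natr mulrC natrM.
by rewrite mulfK ?mulr1 // pnatr_eq0 -lt0n expn_gt0.
Qed.

Section Block.
Variables (n K : nat) (A : {set 'I_n.+1}).
Hypotheses (SA : mult_sidon A) (K2 : (2 <= K)%N) (nK : (n <= 2 ^ (24 * K))%N).

Let Q := (2 ^ (16 * K))%N.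
Let u m := largest_divisor Q m.
Let v m := (m %/ u m)%N.

Definition smooth_part := [set m in A | max_pdiv m <= Q]%N.

(** [j] measures the imbalance between the two factors; it can be taken nonnegative because
    [v m <= u m]. *)
Definition block (j b : nat) :=
  [set m in smooth_part | (trunc_log 16 (u m) == b + j)%N & (trunc_log 16 (v m) == b)%N].

(** For [h = 2 ^ (8 * K)] one has [n <= h ^ 3] and [Q = h ^ 2], the setting of
    [largest_codivisor_le]. *)
Lemma smooth_partP m : m \in smooth_part ->
  [/\ (0 < m)%N, (u m * v m)%N = m, (0 < v m)%N, (u m <= Q)%N & (v m <= u m)%N].
Proof.
rewrite inE => /andP[mA mQ].
have Q0 : (0 < Q)%N by rewrite expn_gt0.
have m0 := mult_sidon_gt0 SA mA.
have [u0 um uQ] := largest_divisorP m0 Q0.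
split => //; first by rewrite mulnC divnK.
  by rewrite divn_gt0 // dvdn_leq.
have := @largest_codivisor_le (2 ^ (8 * K)) m m0.
have mn : (m <= n)%N by rewrite -ltnS.
rewrite -!expnM (_ : 8 * K * 2 = 16 * K)%N; last by lia.
apply; first by apply: leq_trans mn (leq_trans nK _); rewrite leq_exp2l //; lia.
move=> p pp pm; apply: leq_trans mQ; by apply: max_pdiv_max; rewrite mem_primes pp m0.
Qed.

Lemma blockP j b m : m \in block j b ->
  [/\ m \in smooth_part, (16 ^ (b + j) <= u m < 16 ^ (b + j).+1)%N & (16 ^ b <= v m < 16 ^ b.+1)%N].
Proof.
rewrite inE => /and3P[mS /eqP ju /eqP jv]; have [_ _ v0 _ vu] := smooth_partP mS.
split=> //; first by rewrite -ju; apply: trunc_log_bounds => //; apply: leq_trans vu.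
by rewrite -jv; apply: trunc_log_bounds.
Qed.

Lemma block_sub j b : block j b \subset A.
Proof. by apply/subsetP => m; rewrite !inE -andbA => /and3P[]. Qed.

Lemma block_exp_le j b m : m \in block j b -> (b + j <= 4 * K)%N.
Proof.
case/blockP => mS /andP[ub _] _; have [_ _ _ uQ _] := smooth_partP mS.
have := leq_trans ub uQ; rewrite /Q -[16%N]/(2 ^ 4)%N -expnM leq_exp2l //; lia.
Qed.

Lemma block_trivial_bound j b :
  #|block j b|%:R <= 272 * (16 ^+ (b + j) + 4 ^+ (b + j) * 16 ^+ b) :> R.
Proof.
set x : R := 4 ^+ (b + j); set y : R := 16 ^+ b.
have x0 : 0 < x by rewrite exprn_gt0.
have y0 : 0 < y by rewrite exprn_gt0.
have xx : 16 ^+ (b + j) = x ^+ 2 by rewrite /x -exprM mulnC exprM; congr (_ ^+ _); rewrite -natrX.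
(* The optimal parameter is about |V| / sqrt |U|, here [y / x]; adding 1 ensures [1 <= t]. *)
have := @sidon_kovari_sos_turan n A (block j b) u v
  (iota 0 (16 ^ (b + j).+1)) (iota 0 (16 ^ b.+1)) (1 + y / x) SA (block_sub j b) (iota_uniq _ _).
rewrite !size_iota !natrX [16 ^+ (b + j).+1]exprS [16 ^+ b.+1]exprS xx -/y => H.
apply: le_trans (H _ _) _.
- move=> m /blockP[mS /andP[_ um] /andP[_ vm]]; have [_ e _ _ _] := smooth_partP mS.
  by rewrite !mem_iota !add0n um vm e.
- by rewrite lerDl divr_ge0 // ltW.
have h1 : (1 + y / x) * (16 * x ^+ 2) = 16 * x ^+ 2 + 16 * (x * y).
  by field; rewrite gt_eqF.
have h2 : (16 * y) ^+ 2 / (1 + y / x) <= 256 * (x * y).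
  rewrite ler_pdivrMr; last by rewrite addr_gt0 // divr_gt0.
  have -> : 256 * (x * y) * (1 + y / x) = 256 * (x * y) + 256 * y ^+ 2 by field; rewrite gt_eqF.
  have := mulr_gt0 x0 y0; nra.
have := mulr_gt0 x0 y0; have := exprn_gt0 2 x0; nra.
Qed.

(** The bound on [b + j] leaves room below [Q] to multiply [u m] by any prime up to [2 ^ K], so by
    maximality no such prime divides [v m]. *)
Lemma block_rough_codivisor j b m : (0 < b)%N -> (4 * (b + j) <= 13 * K)%N ->
  m \in block j b -> v m \in roughs (2 ^ K) (16 ^ b.+1).
Proof.
move=> b0 jK /blockP[mS /andP[_ um] /andP[vl vm]]; have [m0 e v0 uQ vu] := smooth_partP mS.
rewrite mem_roughs (ltnW vm) andbT; apply/roughP; split.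
  by apply: leq_trans vl; rewrite -[X in (X < _)%N](expn0 16) ltn_exp2l.
move=> p pp pv; rewrite ltnNge; apply/negP => pz.
have Q0 : (0 < Q)%N by rewrite expn_gt0.
have := codivisor_prime_lt m0 Q0 pp pv; rewrite ltnNge => /negP; apply.
apply: leq_trans (leq_mul pz (ltnW um)) _.
by rewrite -[16%N]/(2 ^ 4)%N -expnM -expnD leq_exp2l //; lia.
Qed.

(** Candidates for [u m]: [s] is its part made of primes up to [2 ^ K], at most [u m / v m], and [l]
    is the complementary rough part. *)
Definition block_divisors j b : seq nat :=
  undup [seq s * l | s <- iota 1 (16 ^ j.+1), l <- roughs (2 ^ K) (16 ^ (b + j).+1 %/ s)]%N.

Lemma block_mem_divisors j b m : (0 < b)%N -> (4 * (b + j) <= 13 * K)%N ->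
  m \in block j b -> u m \in block_divisors j b.
Proof.
move=> b0 jK /blockP[mS /andP[ul um] /andP[vl vm]]; have [m0 e v0 uQ vu] := smooth_partP mS.
have Q0 : (0 < Q)%N by rewrite expn_gt0.
have u0 : (0 < u m)%N by apply: leq_trans ul; rewrite expn_gt0.
have v1 : (1 < v m)%N.
  by apply: leq_trans vl; rewrite -[X in (X < _)%N](expn0 16) ltn_exp2l.
pose pi : nat_pred := [pred p | p <= 2 ^ K]%N.
set s := ((u m)`_pi)%N; set l := ((u m)`_(pi^'))%N.
have su : (s * l)%N = u m by exact: partnC.
have sv : (s * v m <= u m)%N.
  apply: (@smooth_divisor_le Q m (2 ^ K)) => //; last 1 first.
  - move=> p pp ps; have := part_pnat pi (u m) => /pnatP -/(_ (part_gt0 _ _)) h.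
    exact: h.
  - apply: leq_trans (leq_mul (ltnW um) (leqnn _)) _.
    by rewrite -[16%N]/(2 ^ 4)%N -expnM -expnD leq_exp2l //; lia.
  - exact: dvdn_part.
have s0 : (0 < s)%N by exact: part_gt0.
rewrite mem_undup; apply/allpairsPdep; exists s, l; split => //.
  rewrite mem_iota s0 add1n ltnS /= ltnW //.
  have : (s * 16 ^ b < 16 ^ j.+1 * 16 ^ b)%N.
    rewrite -expnD addSn [(j + b)%N]addnC; apply: leq_ltn_trans um.
    by apply: leq_trans sv; rewrite leq_mul2l vl orbT.
  by rewrite ltn_mul2r => /andP[].
rewrite mem_roughs leq_divRL // mulnC su (ltnW um) andbT; apply/roughP; split.
  (* From [s * v m <= u m = s * l] follows [l >= v m > 1]. *)
  rewrite ltnNge; apply/negP => l1.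
  have : (s * l < s * v m)%N by rewrite ltn_mul2l s0 (leq_ltn_trans l1).
  by rewrite su ltnNge sv.
move=> p pp pl; have := part_pnat pi^' (u m) => /pnatP -/(_ (part_gt0 _ _)) h.
by have := h p pp pl; rewrite !inE -ltnNge.
Qed.

(** Rough numbers bring the gain [1 / K]; the harmonic sum over [s] up to [16 ^ j.+1] costs the
    factor [j.+1]. *)
Lemma size_block_divisors (D : R) j b :
    (forall X : nat, (X < 2 ^ (17 * K))%N ->
      (size (roughs (2 ^ K) X))%:R <= D * X%:R / K%:R) ->
    (4 * (b + j) <= 13 * K)%N -> 0 <= D ->
  (size (block_divisors j b))%:R <= 256 * D * j.+1%:R * 16 ^+ (b + j) / K%:R.
Proof.
move=> hD jK D0.
apply: le_trans (_ : (size [seq s * l | s <- iota 1 (16 ^ j.+1),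
    l <- roughs (2 ^ K) (16 ^ (b + j).+1 %/ s)]%N)%:R <= _).
  by rewrite ler_nat size_undup.
rewrite size_allpairs_dep sumnE big_map natr_sum.
apply: le_trans (_ : \sum_(s <- iota 1 (16 ^ j.+1))
    D * (16 ^ (b + j).+1)%:R / K%:R * s%:R^-1 <= _).
  rewrite big_seq [leRHS]big_seq; apply: ler_sum => s; rewrite mem_iota => /andP[s0 _].
  apply: le_trans (hD _ _) _.
    apply: leq_ltn_trans (leq_div _ _) _.
    by rewrite -[16%N]/(2 ^ 4)%N -expnM ltn_exp2l //; lia.
  rewrite -!mulrA ler_wpM2l // [_ / s%:R]mulrC mulrA ler_wpM2r ?invr_ge0 //.
  by rewrite ler_pdivlMr ?ltr0n // -natrM ler_nat leq_trunc_div.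
rewrite -mulr_sumr.
apply: le_trans (ler_wpM2l _ (_ : _ <= 16 * j.+1%:R)) _.
- by rewrite divr_ge0 ?mulr_ge0.
- apply: le_trans (sum_inv_le _) _; have : 1 <= j.+1%:R :> R by rewrite ler1n.
  lra.
rewrite natrX exprS le_eqVlt; apply/orP; left; apply/eqP; field.
by rewrite pnatr_eq0 -lt0n; lia.
Qed.

Lemma block_main_bound (D : R) j b :
    (forall X : nat, (X < 2 ^ (17 * K))%N ->
      (size (roughs (2 ^ K) X))%:R <= D * X%:R / K%:R) ->
    1 <= D -> (0 < b)%N -> (2 * j <= K)%N -> (2 * b + j <= 6 * K)%N ->
  #|block j b|%:R <= 512 * D ^+ 2 *
    (16 ^+ (b + j) + j.+1%:R * (4 ^+ (b + j) * 16 ^+ b / (K%:R * Num.sqrt K%:R))) :> R.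
Proof.
move=> hD D1 b0 jK bK.
(* [4 * (b + j) = 2 * (2 * b + j) + 2 * j <= 12 * K + K]. *)
have abK : (4 * (b + j) <= 13 * K)%N by lia.
have D0 : 0 <= D := le_trans ler01 D1.
set x : R := 4 ^+ (b + j); set y : R := 16 ^+ b.
have x0 : 0 < x by rewrite exprn_gt0.
have y0 : 0 < y by rewrite exprn_gt0.
have xx : 16 ^+ (b + j) = x ^+ 2 by rewrite /x -exprM mulnC exprM; congr (_ ^+ _); rewrite -natrX.
have k0 : 0 < K%:R :> R by rewrite ltr0n; lia.
set r := Num.sqrt (K%:R : R).
have r0 : 0 < r by rewrite sqrtr_gt0.
have rr : K%:R = r ^+ 2 by rewrite sqr_sqrtr // ltW.
have t0 : 0 < y / (x * r) by rewrite divr_gt0 // mulr_gt0.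
(* Up to constants and [j], |U| is [x ^+ 2 / K] and |V| is [y / K], so |V| / sqrt |U| is
   [y / (x * r)]. *)
have := @sidon_kovari_sos_turan n A (block j b) u v
  (block_divisors j b) (roughs (2 ^ K) (16 ^ b.+1)) (1 + y / (x * r)) SA (block_sub j b) (undup_uniq _).
move=> H; apply: le_trans (H _ _) _.
- move=> m mB; have [mS _ _] := blockP mB; have [_ e _ _ _] := smooth_partP mS.
  by rewrite e (block_mem_divisors b0 abK mB) (block_rough_codivisor b0 abK mB).
- by rewrite lerDl ltW.
have hU := size_block_divisors hD abK D0.
have hV : (size (roughs (2 ^ K) (16 ^ b.+1)))%:R <= D * (16 * y) / K%:R.
  rewrite /y -exprS -natrX; apply: hD.
  by rewrite -[16%N]/(2 ^ 4)%N -expnM ltn_exp2l //; move: abK K2; clear; lia.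
set J : R := j.+1%:R in hU *.
have J1 : 1 <= J by rewrite ler1n.
have JK : J <= K%:R by rewrite ler_nat; move: jK K2; clear; lia.
have h1 : (1 + y / (x * r)) * (size (block_divisors j b))%:R <=
    256 * D * (x ^+ 2 + J * (x * y / (K%:R * r))).
  apply: le_trans (ler_wpM2l _ hU) _; first by rewrite addr_ge0 // ltW.
  rewrite xx mulrDl mul1r mulrDr; apply: lerD.
    rewrite ler_pdivrMr // -[256 * D * J * _]mulrAC ler_wpM2l //.
    by rewrite mulr_ge0 ?exprn_ge0 ?mulr_ge0 // ltW.
  rewrite le_eqVlt; apply/orP; left; apply/eqP; field.
  by rewrite !gt_eqF.
have h2 : (size (roughs (2 ^ K) (16 ^ b.+1)))%:R ^+ 2 / (1 + y / (x * r)) <=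
    256 * D ^+ 2 * (x * y / (K%:R * r)).
  apply: le_trans (_ : (D * (16 * y) / K%:R) ^+ 2 / (y / (x * r)) <= _).
    apply: ler_pM; first by rewrite exprn_ge0.
    - by rewrite invr_ge0 addr_ge0 // ltW.
    - by rewrite ler_pXn2r ?nnegrE // divr_ge0 // mulr_ge0 // mulr_ge0 // ltW.
    by rewrite lef_pV2 ?posrE ?addr_gt0 // lerDr.
  rewrite rr le_eqVlt; apply/orP; left; apply/eqP; field.
  by rewrite !gt_eqF.
apply: le_trans (lerD h1 h2) _.
set w := x * y / _.
have w0 : 0 < w by rewrite divr_gt0 // mulr_gt0.
have DD : D <= D ^+ 2 by rewrite expr2 ler_peMr // (le_trans ler01).
have Jw : w <= J * w by rewrite ler_peMl // ltW.
have X0 : 0 < x ^+ 2 by rewrite exprn_gt0.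
have : D * (x ^+ 2 + J * w) <= D ^+ 2 * (x ^+ 2 + J * w).
  by rewrite ler_wpM2r //; lra.
have : D ^+ 2 * w <= D ^+ 2 * (x ^+ 2 + J * w).
  by rewrite ler_wpM2l ?exprn_ge0 //; lra.
rewrite xx; lra.
Qed.

End Block.
End Upper.

(** * Multiplicative Sidon sets: summation over the blocks *)

Section Total.
Variable R : rcfType.
Local Open Scope ring_scope.

(** The square of [j.+1] unifies the cases: a single factor suffices when [2 * j <= K], and
    otherwise K * sqrt K <= K^2 <= 4 (j + 1)^2, so that the trivial bound is enough. *)
Lemma block_bound : exists2 C : R, 0 < C &
  forall (n K : nat) (A : {set 'I_n.+1}) (j b : nat),
    mult_sidon A -> (2 <= K)%N -> (n <= 2 ^ (24 * K))%N -> (2 * b + j <= 6 * K)%N ->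
  #|block K A j b|%:R <= C * (16 ^+ (4 * K) +
    j.+1%:R ^+ 2 * (4 ^+ (b + j) * 16 ^+ b) / (K%:R * Num.sqrt K%:R)).
Proof.
have [D D1 hD] := size_roughs_bound R.
have D21 : 1 <= D ^+ 2 by rewrite exprn_ege1.
exists (1100 * D ^+ 2); first by lra.
move=> n K A j b SA K2 nK bK.
have K0 : (0 < K)%N by lia.
have k1 : 1 <= K%:R :> R by rewrite ler1n.
set r := Num.sqrt (K%:R : R).
have rr : K%:R = r ^+ 2 by rewrite sqr_sqrtr // ler0n.
have r1 : 1 <= r by rewrite -sqrtr1 ler_sqrt // (le_trans ler01).
set J : R := j.+1%:R.
have J1 : 1 <= J by rewrite ler1n.
set x : R := 4 ^+ (b + j); set y : R := 16 ^+ b.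
have x0 : 0 < x by rewrite exprn_gt0.
have y0 : 0 < y by rewrite exprn_gt0.
have kr0 : 0 < K%:R * r by apply: mulr_gt0; lra.
set w := J ^+ 2 * (x * y) / (K%:R * r).
have w0 : 0 < w by rewrite divr_gt0 // ?mulr_gt0 // exprn_gt0 //; lra.
have [B0|[m mB]] := set_0Vmem (block K A j b).
  rewrite B0 cards0 mulr_ge0 ?addr_ge0 ?exprn_ge0 //; last exact: ltW.
  by rewrite mulr_ge0 ?exprn_ge0 //; lra.
have aK := block_exp_le SA K2 nK mB.
have xx : x ^+ 2 = 16 ^+ (b + j) by rewrite /x -exprM mulnC exprM; congr (_ ^+ _); rewrite -natrX.
have xz : x ^+ 2 <= 16 ^+ (4 * K) by rewrite xx ler_eXn2l // ltr1n.
set z : R := 16 ^+ (4 * K) in xz *.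
have z0 : 0 < z by rewrite exprn_gt0.
have Dz : z + w <= D ^+ 2 * (z + w) by rewrite ler_peMl // addr_ge0 // ltW.
have triv := block_trivial_bound R SA K2 nK j b.
rewrite -/x -/y -xx in triv.
(* For [b = 0] the cofactor may be 1, which is not rough, but the trivial bound is then of order
   [16 ^+ (4 * K)]. *)
have [b0|b0] := posnP b.
  apply: le_trans triv _.
  have y1 : y = 1 by rewrite /y b0.
  have x1 : 1 <= x by rewrite exprn_ege1 // ler1n.
  have : x <= x ^+ 2 by rewrite expr2 ler_peMr // ltW.
  rewrite y1 mulr1; lra.
have [jK|Kj] := leqP (2 * j) K.
  apply: le_trans (block_main_bound SA K2 nK (hD K ^~ K0) D1 b0 jK bK) _.
  rewrite -/x -/y -/r -xx -/J.
  have : J * (x * y / (K%:R * r)) <= w.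
    rewrite /w -[J ^+ 2 * _ / _]mulrA ler_wpM2r //; last by rewrite expr2 ler_peMl //; lra.
    by apply: divr_ge0; [apply: mulr_ge0; exact: ltW | exact: ltW].
  move=> h; apply: le_trans (_ : 512 * D ^+ 2 * (z + w) <= _); last by lra.
  by apply: ler_wpM2l; lra.
apply: le_trans triv _.
have : x * y <= 4 * w.
  have -> : 4 * w = 4 * J ^+ 2 / (K%:R * r) * (x * y).
    by rewrite /w; field; rewrite !gt_eqF //; lra.
  rewrite ler_peMl //; first by apply: mulr_ge0; exact: ltW.
  rewrite ler_pdivlMr // mul1r.
  have J2 : K%:R <= 2 * J by rewrite -natrM ler_nat; move: Kj; clear; lia.
  have : K%:R * r <= K%:R * K%:R by rewrite ler_wpM2l // rr expr2 ler_peMl //; lra.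
  nra.
lra.
Qed.

Lemma sum_sqr_geometric (n : nat) : \sum_(j < n) (j.+1%:R ^+ 2 / 2 ^+ j : R) <= 12.
Proof.
(* The partial sums have a closed form with limit 12. *)
have -> : \sum_(j < n) (j.+1%:R ^+ 2 / 2 ^+ j : R) =
    12 - 2 * (n%:R ^+ 2 + 4 * n%:R + 6) / 2 ^+ n.
  elim: n => [|n IHn]; first by rewrite big_ord0 mulr0n expr0 divr1; lra.
  rewrite big_ord_recr /= IHn [2 ^+ n.+1]exprS -[n.+1]addn1 natrD; field.
  by rewrite expf_neq0 ?pnatr_eq0.
by rewrite gerBl divr_ge0 ?exprn_ge0 // mulr_ge0 // ?addr_ge0 ?mulr_ge0 ?exprn_ge0.
Qed.

(** [64 ^ b * 8 ^ j = 8 ^ (2 * b + j)]: a geometric progression in [b] whose last term is at most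
    [8 ^ M]. *)
Lemma sum_geometric_le (M j n : nat) :
  (\sum_(b < n | 2 * b + j <= M) 64 ^ b * 8 ^ j <= 2 * 8 ^ M)%N.
Proof.
elim: n => [|n IHn]; first by rewrite big_ord0.
rewrite big_mkcond big_ord_recr /= -big_mkcond /=; case: (leqP (2 * n + j) M) => [h|_]; last by rewrite addn0.
apply: leq_trans (_ : (2 * (64 ^ n * 8 ^ j) <= _)%N); last first.
  rewrite leq_mul2l /= -[64%N]/(8 ^ 2)%N -expnM -expnD leq_exp2l //.
rewrite mul2n -addnn leq_add2r -big_distrl leq_mul2r; apply/orP; right.
apply: leq_trans (_ : (\sum_(b < n) 64 ^ b <= _)%N).
  by rewrite [leqRHS](bigID (fun b : 'I_n => 2 * b + j <= M)%N) leq_addr.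
elim: (n) => [|k IHk]; first by rewrite big_ord0.
rewrite big_ord_recr expnS; apply: leq_trans (leq_add IHk (leqnn _)) _.
by rewrite addnn -mul2n leq_mul2r orbT.
Qed.

Lemma smooth_part_le (n K : nat) (A : {set 'I_n.+1}) :
    mult_sidon A -> (2 <= K)%N -> (n <= 2 ^ (24 * K))%N ->
  (#|smooth_part K A| <= \sum_(j < (6 * K).+1) \sum_(b < (6 * K).+1 | 2 * b + j <= 6 * K)
    #|block K A j b|)%N.
Proof.
move=> SA K2 nK; pose Q := (2 ^ (16 * K))%N.
pose u m := largest_divisor Q m; pose v m := (m %/ u m)%N.
pose h (m : 'I_n.+1) := ((inord (trunc_log 16 (u m) - trunc_log 16 (v m)),
   inord (trunc_log 16 (v m))) : 'I_(6 * K).+1 * 'I_(6 * K).+1).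
have hP m : m \in smooth_part K A ->
    [/\ trunc_log 16 (u m) = (trunc_log 16 (v m) + (h m).1)%N,
        trunc_log 16 (v m) = (h m).2 & 2 * (h m).2 + (h m).1 <= 6 * K]%N.
  move=> mS; have [m0 e v0 uQ vu] := smooth_partP SA K2 nK mS.
  have u0 : (0 < u m)%N by apply: leq_trans vu.
  have ba : (trunc_log 16 (v m) <= trunc_log 16 (u m))%N by apply: leq_trunc_log.
  (* The product of the two factors is [m], and [n <= 16 ^ (6 * K)]. *)
  have ab : (trunc_log 16 (u m) + trunc_log 16 (v m) <= 6 * K)%N.
    rewrite -(@leq_exp2l 16) // expnD.
    apply: leq_trans (leq_mul (trunc_logP _ u0) (trunc_logP _ v0)) _ => //.
    rewrite e; have mn : (m <= n)%N by rewrite -ltnS.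
    apply: leq_trans mn (leq_trans nK _).
    by rewrite -[16%N]/(2 ^ 4)%N -expnM leq_exp2l //; lia.
  rewrite /h /= !inordK; [|lia|lia].
  by split => //; lia.
rewrite -sum1_card pair_big_dep /=.
rewrite (partition_big h (fun p => 2 * p.2 + p.1 <= 6 * K)%N) /=; last by move=> m /hP[].
apply: leq_sum => p _; rewrite sum1_card; apply: subset_leq_card; apply/subsetP => m.
rewrite unfold_in => /andP[mS /eqP hp]; have [e1 e2 _] := hP m mS.
by rewrite in_set mS -/u -/v e1 e2 hp !eqxx.
Qed.

Lemma sidon_card_le : exists2 C : R, 0 < C &
  forall (n K : nat) (A : {set 'I_n.+1}),
    mult_sidon A -> (3 <= K)%N -> (n <= 2 ^ (24 * K))%N ->
  #|A|%:R <= (prime_count n)%:R + C * (2 ^+ (18 * K) / (K%:R * Num.sqrt K%:R)).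
Proof.
have [C C0 hC] := block_bound.
exists (100 + 200 * C); first by lra.
move=> n K A SA K3 nK.
have K0 : (0 < K)%N by lia.
have k1 : 1 <= K%:R :> R by rewrite ler1n.
set r := Num.sqrt (K%:R : R).
have rr : K%:R = r ^+ 2 by rewrite sqr_sqrtr // ler0n.
have r1 : 1 <= r by rewrite -sqrtr1 ler_sqrt // (le_trans ler01).
have kr0 : 0 < K%:R * r by apply: mulr_gt0; lra.
have krK : K%:R * r <= K%:R ^+ 2 by rewrite expr2 ler_wpM2l // rr expr2 ler_peMl //; lra.
set E := 2 ^+ (18 * K) / (K%:R * r).
(* The error [16 ^+ (4 * K)] paid in each block is harmless: [2 ^ (18 * K)] exceeds it by [4 ^ K],
   which outgrows [K ^ 4] up to a constant. *)
have small : (6 * K).+1%:R ^+ 2 * 16 ^+ (4 * K) <= 98 * E.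
  rewrite /E mulrA ler_pdivlMr //.
  have -> : (2 : R) ^+ (18 * K) = 4 ^+ K * 16 ^+ (4 * K).
    rewrite (_ : 4 = 2 ^+ 2); last by rewrite -natrX.
    rewrite (_ : 16 = 2 ^+ 4); last by rewrite -natrX.
    by rewrite -!exprM -exprD; congr (_ ^+ _); lia.
  rewrite mulrAC [98 * _]mulrA ler_wpM2r ?exprn_ge0 //.
  apply: le_trans (_ : (6 * K).+1%:R ^+ 2 * K%:R ^+ 2 <= _).
    by rewrite ler_wpM2l ?exprn_ge0.
  rewrite -!natrX -!natrM ler_nat.
  have K4 : (K ^ 4 <= 2 * 4 ^ K)%N.
    elim: K K3 {nK K0 k1 r rr r1 kr0 krK E} => // K IHK K3.
    have [->//|K3'] := eqVneq K 2.
    have := IHK ltac:(lia); rewrite [(4 ^ K.+1)%N]expnS.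
    have : (K.+1 ^ 4 <= 4 * K ^ 4)%N.
      have K4 : (3 <= K)%N by lia.
      have h : (K.+1 ^ 2 <= 2 * K ^ 2)%N by nia.
      rewrite -[4%N]/(2 * 2)%N !expnM; apply: leq_trans (_ : ((2 * K ^ 2) ^ 2 <= _)%N); last by nia.
      by rewrite leq_exp2r.
    lia.
  have : ((6 * K).+1 ^ 2 * K ^ 2 <= 49 * K ^ 4)%N.
    rewrite -[4%N]/(2 + 2)%N expnD mulnA leq_mul2r; apply/orP; right; nia.
  lia.
have z1 : 1 <= (6 * K).+1%:R ^+ 2 :> R by rewrite exprn_ege1 // ler1n.
have z0 : 0 < 16 ^+ (4 * K) :> R by rewrite exprn_gt0.
have E0 : 0 < E by rewrite divr_gt0 // exprn_gt0.
have split_card : (#|A| = #|[set m in A | 2 ^ (16 * K) < max_pdiv m]%N| + #|smooth_part K A|)%N.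
  rewrite -(cardsID [set m : 'I_n.+1 | 2 ^ (16 * K) < max_pdiv m]%N A).
  congr (_ + _)%N; apply: eq_card => m; rewrite !inE //.
  by rewrite -leqNgt andbC.
rewrite split_card natrD.
have large := sidon_large_prime R SA nK.
have e16 : 2 ^+ (16 * K) = 16 ^+ (4 * K) :> R.
  rewrite (_ : (16 : R) = 2 ^+ 4); last by rewrite -natrX.
  by rewrite -exprM; congr (_ ^+ _); clear; lia.
rewrite e16 in large.
have := smooth_part_le SA (ltnW K3) nK; rewrite -(ler_nat R) => blocks.
suff : (#|smooth_part K A|)%:R <= C * ((6 * K).+1%:R ^+ 2 * 16 ^+ (4 * K) + 24 * E).
  have : C * ((6 * K).+1%:R ^+ 2 * 16 ^+ (4 * K)) <= C * (98 * E) by rewrite ler_wpM2l // ltW.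
  have : 16 ^+ (4 * K) <= (6 * K).+1%:R ^+ 2 * 16 ^+ (4 * K) :> R by rewrite ler_peMl // ltW.
  have : 0 < C * E by rewrite mulr_gt0.
  lra.
apply: le_trans blocks _; rewrite natr_sum.
(* [4 ^ (b + j) * 16 ^ b = 64 ^ b * 8 ^ j / 2 ^ j]. The sum over [b] is at most
   [2 * 8 ^ (6 * K) = 2 * 2 ^ (18 * K)], and the series in [j] is at most 12, whence the 24
   above. *)
apply: le_trans (_ : \sum_(j < (6 * K).+1) \sum_(b < (6 * K).+1 | (2 * b + j <= 6 * K)%N)
   (C * 16 ^+ (4 * K) +
    C / (K%:R * r) * (j.+1%:R ^+ 2 / 2 ^+ j) * (64 ^ b * 8 ^ j)%:R) <= _).
  apply: ler_sum => j _; rewrite natr_sum; apply: ler_sum => b jb.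
  apply: le_trans (hC n K A j b SA (ltnW K3) nK jb) _.
  rewrite mulrDr lerD2l natrM !natrX -/r.
  rewrite (_ : (64 : R) = 4 * 16); last by rewrite -natrM.
  rewrite (_ : (8 : R) = 4 * 2); last by rewrite -natrM.
  rewrite exprD !exprMn le_eqVlt; apply/orP; left; apply/eqP; field.
  by rewrite !gt_eqF ?exprn_gt0 //; lra.
under eq_bigr do rewrite big_split /=.
rewrite big_split /= mulrDr; apply: lerD.
  apply: le_trans (_ : \sum_(j < (6 * K).+1) \sum_(b < (6 * K).+1) C * 16 ^+ (4 * K) <= _).
    apply: ler_sum => j _; rewrite [leRHS](bigID (fun b : 'I__ => 2 * b + j <= 6 * K)%N) /= lerDl.
    by apply: sumr_ge0 => b _; rewrite mulr_ge0 // ltW.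
  rewrite !sumr_const !card_ord -mulrnA -[_ *+ (_ * _)]mulr_natr natrM.
  by rewrite le_eqVlt; apply/orP; left; apply/eqP; ring.
apply: le_trans (_ : \sum_(j < (6 * K).+1) C / (K%:R * r) * (j.+1%:R ^+ 2 / 2 ^+ j) * (2 * 8 ^ (6 * K))%:R <= _).
  apply: ler_sum => j _; rewrite -mulr_sumr -natr_sum ler_wpM2l //.
    by rewrite mulr_ge0 ?divr_ge0 ?exprn_ge0 // ltW.
  by rewrite ler_nat sum_geometric_le.
rewrite -mulr_suml -mulr_sumr.
have e18 : (2 * 8 ^ (6 * K))%:R = 2 * 2 ^+ (18 * K) :> R.
  rewrite natrM natrX (_ : (8 : R) = 2 ^+ 3); last by rewrite -natrX.
  by rewrite -exprM; congr (_ * _ ^+ _); clear; lia.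
rewrite e18; have := sum_sqr_geometric (6 * K).+1; set S := \sum_(_ < _) _ => S12.
have -> : C / (K%:R * r) * S * (2 * 2 ^+ (18 * K)) = 2 * C * E * S.
  by rewrite /E; field; rewrite !gt_eqF //; lra.
have CE : 0 < C * E by rewrite mulr_gt0.
nra.
Qed.

End Total.

(** * The construction *)

Lemma trivial_solution_count (d : nat) (s : seq nat) : 0 < d ->
  {in s, forall x, d %| count_mem x s} -> trivial_solution d s.
Proof.
move=> d0 H.
have count_flat (e : nat -> nat) (b : seq nat) (x : nat) :
    count_mem x (flatten [seq nseq (e y) y | y <- b]) = \sum_(y <- b | y == x) e y.
  elim: b => [|y b IHb]; first by rewrite big_nil.
  rewrite /= count_cat IHb count_nseq big_cons /=.
  by case: (y == x); rewrite ?mul1n ?mul0n.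
(* Each distinct [x] heads as many blocks as its multiplicity allows. *)
exists (flatten [seq nseq (count_mem x s %/ d) x | x <- undup s]).
rewrite -[perm_eq _ _]/(all _ _); apply/allP => x _ /=; apply/eqP.
rewrite count_flat -big_filter big_const_seq count_predT size_filter count_flat iter_addn_0.
have [xs|xs] := boolP (x \in s).
  rewrite -big_filter filter_pred1_uniq ?undup_uniq ?mem_undup // big_seq1.
  by rewrite mulnC divnK // H.
rewrite big_hasC; first by rewrite muln0 (count_memPn xs).
by apply/hasPn => y; rewrite mem_undup; apply: contraTneq => ->.
Qed.

(** * Edge weights with all degrees divisible by 3 *)

Section Weights.
Variables (X Y : finType) (W : X -> Y -> nat).
Hypotheses (rows : forall x, 3 %| \sum_y W x y) (cols : forall y, 3 %| \sum_x W x y).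
Hypothesis total : \sum_x \sum_y W x y <= 6.
Hypothesis C4 : forall x x' y y',
  0 < W x y -> 0 < W x y' -> 0 < W x' y -> 0 < W x' y' -> x = x' \/ y = y'.

(** A vertex on a bad edge (weight not divisible by 3) lies on a second one, since its degree is a
    multiple of 3. This extends a bad edge [x y] to a path y', x, y, x', y2. If y2 = y' it closes
    into a C4; otherwise three columns of weight at least 3 exceed the total 6. *)
Lemma weights_dvd3 (x : X) (y : Y) : 3 %| W x y.
Proof.
have row_other x1 y1 : ~~ (3 %| W x1 y1) -> exists2 y2, y2 != y1 & ~~ (3 %| W x1 y2).
  move=> h; apply/exists_inP; apply: contraNT h; rewrite negb_exists_in => /forall_inP h.
  have := rows x1; rewrite (bigD1 y1) //= dvdn_addl //.
  by apply: dvdn_sum => y2 /h; rewrite negbK.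
have col_other x1 y1 : ~~ (3 %| W x1 y1) -> exists2 x2, x2 != x1 & ~~ (3 %| W x2 y1).
  move=> h; apply/exists_inP; apply: contraNT h; rewrite negb_exists_in => /forall_inP h.
  have := cols y1; rewrite (bigD1 x1) //= dvdn_addl //.
  by apply: dvdn_sum => x2 /h; rewrite negbK.
have pos x1 y1 : ~~ (3 %| W x1 y1) -> 0 < W x1 y1 by case: (W x1 y1).
have col3 x1 y1 : ~~ (3 %| W x1 y1) -> 3 <= \sum_x W x y1.
  move=> /pos h; apply: dvdn_leq => //.
  by apply: leq_trans h _; rewrite (bigD1 x1) //= leq_addr.
apply/idPn => h.
have [y' y'y h1] := row_other _ _ h.
have [x' x'x h2] := col_other _ _ h.
have [y2 y2y h3] := row_other _ _ h2.
have [e|y2y'] := eqVneq y2 y'.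
  rewrite e in h3.
  by case: (C4 (pos _ _ h) (pos _ _ h1) (pos _ _ h2) (pos _ _ h3)) => e'; subst; rewrite eqxx in x'x y'y.
move: total; rewrite exchange_big (bigD1 y) //= (bigD1 y') //= (bigD1 y2) /=; last by rewrite y2y y2y'.
move: (col3 _ _ h) (col3 _ _ h1) (col3 _ _ h3); lia.
Qed.
End Weights.

Lemma sum_pred1 (T : finType) (c : bool) (b : T) : \sum_(y : T) (c && (b == y)) = c.
Proof.
rewrite (bigD1 b) //= eqxx andbT big1 ?addn0 // => y.
by rewrite eq_sym => /negbTE->; rewrite andbF.
Qed.

Lemma count_memE (T : eqType) (s : seq T) (x : T) : count_mem x s = \sum_(y <- s) (y == x).
Proof. by rewrite -sum1_count big_mkcond; apply: eq_bigr => y _ /=; case: (y == x). Qed.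

Lemma logn_prod_seq (p : nat) (s : seq nat) : all (leq 1) s ->
  logn p (\prod_(m <- s) m) = \sum_(m <- s) logn p m.
Proof.
elim: s => [|m s IHs] /=; first by rewrite !big_nil logn1.
case/andP=> m0 s0; rewrite !big_cons lognM ?IHs //.
by rewrite big_seq prodn_cond_gt0 // => i /(allP s0).
Qed.

Section GraphConstruction.
Variables (X Y : finType) (I : X -> Y -> bool) (point : X -> nat) (line : Y -> nat) (h n : nat).
Hypotheses (point_prime : forall x, prime (point x)) (line_prime : forall y, prime (line y)).
Hypotheses (point_inj : injective point) (line_inj : injective line).
Hypothesis point_line : forall x y, point x != line y.
Hypotheses (point_le : forall x, point x <= h) (line_le : forall y, line y <= h) (hn : h * h <= n).
Hypothesis I_C4 : forall x x' y y', I x y -> I x y' -> I x' y -> I x' y' -> x = x' \/ y = y'.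

(** [inord] never takes its default value 0, as the product is at most [h * h <= n]. *)
Definition edge_product (p : X * Y) : 'I_n.+1 := inord (point p.1 * line p.2).

Definition edge_set : {set X * Y} := [set p | I p.1 p.2].

(** Primes up to [h] are given up, so that a label divides only the products of its own edges. *)
Definition graph_set : {set 'I_n.+1} :=
  [set i : 'I_n.+1 | prime i && (h < i)] :|: edge_product @: edge_set.

Lemma edge_productE p : edge_product p = point p.1 * line p.2 :> nat.
Proof. by rewrite inordK // ltnS (leq_trans _ hn) // leq_mul. Qed.

Lemma logn_edge_product_point x p : logn (point x) (edge_product p) = (x == p.1).
Proof.
rewrite edge_productE lognM ?prime_gt0 // !logn_prime //.
by rewrite (negbTE (point_line _ _)) addn0 (inj_eq point_inj).
Qed.

Lemma logn_edge_product_line y p : logn (line y) (edge_product p) = (y == p.2).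
Proof.
rewrite edge_productE lognM ?prime_gt0 // !logn_prime //.
by rewrite eq_sym (negbTE (point_line _ _)) add0n (inj_eq line_inj).
Qed.

Lemma edge_product_inj : injective edge_product.
Proof.
move=> [x y] [x' y'] e.
have := logn_edge_product_point x (x, y); rewrite e logn_edge_product_point eqxx /=.
have := logn_edge_product_line y (x, y); rewrite e logn_edge_product_line eqxx /=.
by do 2!case: eqP => // ->.
Qed.

Lemma edge_product_prime p : prime (edge_product p) = false.
Proof.
apply/negP; rewrite edge_productE => /primeP[_ H].
have := H _ (dvdn_mulr (line p.2) (dvdnn (point p.1))).
rewrite gtn_eqF ?prime_gt1 //= => /eqP; have := prime_gt1 (line_prime p.2).
have := prime_gt0 (point_prime p.1); nia.
Qed.

Lemma graph_setP m : m \in graph_set ->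
  (prime m /\ h < m) \/ (exists2 p, I p.1 p.2 & m = edge_product p).
Proof.
case/setUP; first by rewrite inE => /andP[]; left.
by case/imsetP => p; rewrite inE => pI ->; right; exists p.
Qed.

Lemma card_graph_set : #|graph_set| + prime_count h = prime_count n + #|edge_set|.
Proof.
have disj : [disjoint [set i : 'I_n.+1 | prime i && (h < i)] & edge_product @: edge_set].
  rewrite -setI_eq0; apply/eqP/setP => m; rewrite in_setI in_set in_set0.
  apply/negP => /andP[/andP[pm _] /imsetP[p _ e]].
  by rewrite e edge_product_prime in pm.
rewrite cardsU disjoint_setI0 // cards0 subn0 (card_imset _ edge_product_inj).
have hn' : h <= n by case: (h) hn => // k; apply: leq_trans; rewrite leq_pmulr.
have -> : #|[set i : 'I_n.+1 | prime i && (h < i)]| = count prime (iota h.+1 (n - h)).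
  rewrite -sum1dep_card -(big_mkord (fun i => prime i && (h < i)) (fun=> 1)).
  rewrite sum1_count /index_iota subn0 (_ : n.+1 = h.+1 + (n - h)); last lia.
  rewrite iotaD count_cat add0n -[RHS]add0n; congr (_ + _).
    by apply/eqP; rewrite -leqn0 leqNgt -has_count; apply/hasPn => i;
      rewrite mem_iota add0n ltnS => /andP[_ ih]; rewrite negb_and -leqNgt ih orbT.
  by apply: eq_in_count => i; rewrite mem_iota => /andP[-> _]; rewrite andbT.
have := prime_countD h (n - h); rewrite subnKC // => ->.
by rewrite addnAC [X in X + _]addnC.
Qed.

Lemma graph_set_only_trivial : only_trivial_solutions 6 3 graph_set.
Proof.
have A0 m : m \in graph_set -> 0 < m.
  case/graph_setP=> [[_]|[p _ ->]]; first exact: leq_trans.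
  by rewrite edge_productE muln_gt0 !prime_gt0.
split; first by apply/negP => /A0.
move=> a x aA ex; set s := map val a.
have sA m : m \in s -> exists2 i, i \in graph_set & m = i :> nat.
  by case/mapP => i /tnthP[j ->] ->; exists (tnth a j).
have s0 : all (leq 1) s by apply/allP => m /sA[i /A0 ? ->].
have prodE : \prod_(m <- s) m = `|x|%N ^ 3.
  by rewrite big_map big_tuple -abszX -ex.
have logn3 p : 3 %| \sum_(m <- s) logn p m.
  by rewrite -logn_prod_seq // prodE lognX dvdn_mulr.
have edge_eq x1 y1 p : I p.1 p.2 ->
    I x1 y1 && (edge_product p == edge_product (x1, y1) :> nat) = (p.1 == x1) && (p.2 == y1).
  case: p => x2 y2 /= pI; rewrite (inj_eq val_inj) (inj_eq edge_product_inj) xpair_eqE.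
  by case: (x2 =P x1) => [<-|_]; case: (y2 =P y1) => [<-|_]; rewrite ?pI ?andbF.
have prime_eq x1 y1 m : prime m -> I x1 y1 && (m == edge_product (x1, y1) :> nat) = false.
  by move=> pm; apply/negP => /andP[_ /eqP e]; rewrite e edge_product_prime in pm.
have row m x1 : m \in s -> \sum_y (I x1 y && (m == edge_product (x1, y) :> nat)) = logn (point x1) m.
  case/sA => i /graph_setP[[pm hm]|[p pI ->]] ->.
    rewrite big1; last by move=> y _; rewrite prime_eq.
    by rewrite logn_prime // ltn_eqF // (leq_ltn_trans _ hm).
  rewrite logn_edge_product_point eq_sym -(sum_pred1 _ p.2).
  by apply: eq_bigr => y _; rewrite edge_eq.
have col m y1 : m \in s -> \sum_x (I x y1 && (m == edge_product (x, y1) :> nat)) = logn (line y1) m.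
  case/sA => i /graph_setP[[pm hm]|[p pI ->]] ->.
    rewrite big1; last by move=> y _; rewrite prime_eq.
    by rewrite logn_prime // ltn_eqF // (leq_ltn_trans _ hm).
  rewrite logn_edge_product_line eq_sym -(sum_pred1 _ p.1).
  by apply: eq_bigr => x1 _; rewrite edge_eq // andbC.
(* The multiplicity of each edge in the solution; row and column sums are the exponents of the
   labels in the cube. *)
pose W x y := \sum_(m <- s) (I x y && (m == edge_product (x, y) :> nat)).
have rowW x1 : \sum_y W x1 y = \sum_(m <- s) logn (point x1) m.
  by rewrite exchange_big; apply: eq_big_seq => m /row.
have colW y1 : \sum_x W x y1 = \sum_(m <- s) logn (line y1) m.
  by rewrite exchange_big; apply: eq_big_seq => m /col.
have W_I x1 y1 : 0 < W x1 y1 -> I x1 y1.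
  by rewrite /W; case: (I x1 y1) => //; rewrite big1.
have W3 x1 y1 : 3 %| W x1 y1.
  apply: weights_dvd3.
  - by move=> x2; rewrite rowW.
  - by move=> y2; rewrite colW.
  (* Each of the six factors is at most one edge. *)
  - under eq_bigr do rewrite rowW.
    rewrite exchange_big /= -[6](size_tuple a) -(size_map val) -/s -sum1_size.
    rewrite big_seq [leqRHS]big_seq; apply: leq_sum => m /sA[i iA ->].
    case/graph_setP: iA => [[pm hm]|[p pI ->]].
      rewrite big1 // => x2 _.
      by rewrite logn_prime // ltn_eqF // (leq_ltn_trans _ hm).
    under eq_bigr do rewrite logn_edge_product_point eq_sym -[_ == _]andTb.
    by rewrite sum_pred1.
  - move=> x2 x3 y2 y3 /W_I h1 /W_I h2 /W_I h3 /W_I h4; exact: I_C4 h1 h2 h3 h4.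
apply: trivial_solution_count => // m ms; rewrite count_memE.
have [i iA em] := sA m ms; case/graph_setP: iA => [[pm hm]|[p pI ei]].
  (* A prime above [h] divides no other element of the set, so its multiplicity is its exponent in
     the cube. *)
  rewrite (eq_big_seq (logn m)) // => m' /sA[i' i'A ->]; case/graph_setP: i'A => [[pm' hm']|[p pI ->]].
    by rewrite logn_prime ?em // eq_sym.
  rewrite edge_productE lognM ?prime_gt0 // !logn_prime ?em //.
  rewrite (_ : (_ * _ == _) = false); last first.
    by apply/negP => /eqP e; move: pm; rewrite -e -edge_productE edge_product_prime.
  by rewrite !gtn_eqF ?(leq_ltn_trans _ hm).
have := W3 p.1 p.2; rewrite /W pI em ei.
by under eq_bigr do rewrite -surjective_pairing.
Qed.

Lemma f_max_graph : prime_count n + #|edge_set| <= f_max 6 3 n + prime_count h.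
Proof.
rewrite -card_graph_set leq_add2r /f_max.
apply: (@leq_bigmax_cond _ _ (fun A : {set 'I_n.+1} => #|A|)).
exact/asboolP/graph_set_only_trivial.
Qed.

End GraphConstruction.

(** * Points and lines of an affine plane *)

Section Incidence.
Variable F : finFieldType.
Local Open Scope ring_scope.

(** [y] is the line of slope [y.1] and intercept [y.2]; vertical lines are left out. *)
Definition incident (x y : F * F) : bool := x.2 == y.1 * x.1 + y.2.

Lemma incident_C4 (x x' y y' : F * F) :
  incident x y -> incident x y' -> incident x' y -> incident x' y' -> x = x' \/ y = y'.
Proof.
case: x x' y y' => [a b] [a' b'] [m c] [m' c'].
rewrite /incident /= => /eqP e1 /eqP e2 /eqP e3 /eqP e4.
have : (m - m') * (a - a') == 0.
  apply/eqP; transitivity ((m * a + c) - (m' * a + c') - ((m * a' + c) - (m' * a' + c'))); first by ring.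
  by rewrite -e1 -e2 -e3 -e4; ring.
rewrite mulf_eq0 !subr_eq0 => /orP[/eqP em|/eqP ea].
  by right; move: e2; rewrite e1 em => /addrI->.
by left; rewrite e1 e3 ea.
Qed.

(** A point and a slope determine a line through that point. *)
Lemma card_incident : (#|F| ^ 3 <= #|edge_set incident|)%N.
Proof.
pose f (t : F * F * F) := (t.1, (t.2, t.1.2 - t.2 * t.1.1)).
have f_inj : injective f by move=> [x m] [x' m'] [-> -> _].
have <- : #|{: F * F * F}| = (#|F| ^ 3)%N by rewrite !card_prod !expnS expn0 muln1 mulnA.
rewrite -cardsT -(card_imset _ f_inj); apply: subset_leq_card.
apply/subsetP => _ /imsetP[[[a b] m] _ ->].
by rewrite inE /incident /f /= addrC subrK.
Qed.

End Incidence.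

Lemma f_max_lower (l k n : nat) : 0 < l -> 2 * 4 ^ l <= prime_count (2 ^ k) -> 4 ^ k <= n ->
  prime_count n + 8 ^ l <= f_max 6 3 n + prime_count (2 ^ k).
Proof.
move=> l0 lk kn.
have [F _ cardF] := pPrimePowerField (isT : prime 2) l0.
pose ps := [seq p <- iota 1 (2 ^ k) | prime p].
have size_ps : size ps = prime_count (2 ^ k) by rewrite size_filter.
pose N := #|{: F * F}|.
have NE : N = 4 ^ l by rewrite /N card_prod cardF -expnMn.
have NN : N + N <= size ps by rewrite size_ps NE addnn -mul2n.
(* The first [N] primes label the points and the next [N] the lines, so the default of [nth] is
   never reached. *)
pose point (x : F * F) := nth 0 ps (enum_rank x).
pose line (y : F * F) := nth 0 ps (N + enum_rank y).
have ltN (x : F * F) : enum_rank x < N by [].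
have lt1 (x : F * F) : enum_rank x < size ps by apply: leq_trans (ltN x) (leq_trans (leq_addr _ _) NN).
have lt2 (x : F * F) : N + enum_rank x < size ps by apply: leq_trans NN; rewrite ltn_add2l.
have ups : uniq ps by rewrite filter_uniq ?iota_uniq.
have psP i : i < size ps -> prime (nth 0 ps i) /\ nth 0 ps i <= 2 ^ k.
  by move/(mem_nth 0); rewrite mem_filter mem_iota add1n ltnS => /and3P[].
have := @f_max_graph (F * F)%type (F * F)%type (@incident F) point line (2 ^ k) n.
have -> : 8 ^ l = #|F| ^ 3 by rewrite cardF -!expnM mulnC expnM.
move=> H; apply: leq_trans (H _ _ _ _ _ _ _ _ _).
- by rewrite leq_add2l card_incident.
- by move=> x; have [] := psP _ (lt1 x).
- by move=> x; have [] := psP _ (lt2 x).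
- by move=> x y /eqP; rewrite nth_uniq // => /eqP/val_inj/enum_rank_inj.
- by move=> x y /eqP; rewrite nth_uniq // eqn_add2l => /eqP/val_inj/enum_rank_inj.
- by move=> x y; rewrite nth_uniq // ltn_eqF // (leq_trans (ltN x)) // leq_addr.
- by move=> x; have [] := psP _ (lt1 x).
- by move=> x; have [] := psP _ (lt2 x).
- by rewrite -expnMn.
- exact: incident_C4.
Qed.

From mathcomp Require Import all_classical all_reals all_analysis.

(** * Growth of the main term *)

Lemma trunc_log_large (m : nat) : exists N, forall n, N <= n -> 0 < n /\ m <= trunc_log 2 n.
Proof.
exists (2 ^ m) => n mn; split; last exact: trunc_log_max.
by apply: leq_trans mn; rewrite expn_gt0.
Qed.

Section Growth.
Variable R : realType.
Local Open Scope ring_scope.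

(** The power 3/2 on nonnegative reals, in the shape [K * sqrt K] of the Sidon bound. *)
Definition pow32 (y : R) : R := y * Num.sqrt y.

Lemma pow32_le (x y : R) : 0 <= x -> x <= y -> pow32 x <= pow32 y.
Proof. by move=> x0 xy; apply: ler_pM; rewrite ?sqrtr_ge0 // ler_wsqrtr. Qed.

Lemma pow32M (x y : R) : 0 <= x -> pow32 (x * y) = pow32 x * pow32 y.
Proof. by move=> x0; rewrite /pow32 sqrtrM // mulrACA. Qed.

Lemma pow32V (x : R) : 0 <= x -> pow32 x^-1 = (pow32 x)^-1.
Proof. by move=> x0; rewrite /pow32 sqrtrV // invfM. Qed.

Lemma pow32_gt0 (x : R) : 0 < x -> 0 < pow32 x.
Proof. by move=> x0; rewrite mulr_gt0 // sqrtr_gt0. Qed.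

Lemma pow32_sqr (x : R) : 0 <= x -> pow32 (x ^+ 2) = x ^+ 3.
Proof. by move=> x0; rewrite /pow32 sqrtr_sqr ger0_norm // -exprSr. Qed.

Lemma powR32 (a : R) : 0 <= a -> a `^ (3 / 2) = pow32 a.
Proof.
move=> a0; have -> : 3 / 2 = 1 + 2^-1 :> R by field.
rewrite powRD ?powRr1 ?powR12_sqrt //; apply/implyP => /eqP; lra.
Qed.

(** This reduces both bounds to estimates of sqrt x / ln x, by monotonicity of [pow32]. *)
Lemma main_term (x : R) : 1 < x ->
  x `^ (3 / 4) / (ln x) `^ (3 / 2) = pow32 (Num.sqrt x / ln x).
Proof.
move=> x1; have l0 := ln_gt0 x1; have x0 : 0 <= x by apply: ltW; apply: lt_trans x1.
have -> : 3 / 4 = 2^-1 * (3 / 2) :> R by field.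
rewrite powRrM powR12_sqrt // !powR32 ?sqrtr_ge0 ?ltW //.
by rewrite pow32M ?sqrtr_ge0 // pow32V // ltW.
Qed.

Lemma ln2_le1 : ln 2 <= 1 :> R.
Proof. by have := @le_ln1Dx R 1; rewrite (_ : 1 + 1 = 2) //; apply; lra. Qed.

Lemma ln2_ge : 1 <= 2 * ln 2 :> R.
Proof.
have := @le_ln1Dx R (- 2^-1); rewrite (_ : 1 + - 2^-1 = 2^-1); last by field.
rewrite lnV ?posrE //; have h : (-1 : R) < - 2^-1 by lra.
by move=> /(_ h); lra.
Qed.

Lemma sqrt_div_ln_le (k n : nat) : (0 < k)%N -> (4 ^ k <= n < 4 ^ k.+1)%N ->
  Num.sqrt n%:R / ln n%:R <= 2 * 2 ^+ k / k%:R :> R.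
Proof.
move=> k0 /andP[kn nk].
have k0' : 0 < k%:R :> R by rewrite ltr0n.
have n0 : 0 < n%:R :> R by rewrite ltr0n (leq_trans _ kn) // expn_gt0.
have lk : k%:R <= ln n%:R :> R.
  apply: le_trans (_ : ln ((4 ^ k)%:R) <= _); last by rewrite ler_ln ?posrE // ?ltr0n ?expn_gt0 // ler_nat.
  rewrite (_ : 4 = 2 ^ 2)%N // -expnM natrX lnXn // -[_ *+ (_ * _)]mulr_natr natrM.
  have := ln2_ge; have := ltW k0'; nra.
have sn : Num.sqrt n%:R <= 2 * 2 ^+ k :> R.
  rewrite -exprS -[leRHS]ger0_norm ?exprn_ge0 // -sqrtr_sqr ler_wsqrtr //.
  rewrite -exprM mulnC exprM -!natrX ler_nat; exact: ltnW.
apply: ler_pM; [exact: sqrtr_ge0 | | exact: sn | ].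
  by rewrite invr_ge0 (le_trans _ lk) // ltW.
by rewrite lef_pV2 ?posrE // (lt_le_trans k0').
Qed.

(** The factor 24 comes from [ln n <= 24 * K], and [2 ^+ 12] from passing from [K.-1] to [K] in the
    exponent. *)
Lemma sqrt_div_ln_ge (K n : nat) : (0 < K)%N -> (1 < n)%N ->
    (2 ^ (24 * K.-1) <= n < 2 ^ (24 * K))%N ->
  2 ^+ (12 * K) / K%:R <= 24 * 2 ^+ 12 * (Num.sqrt n%:R / ln n%:R) :> R.
Proof.
move=> K0 n1 /andP[Kn nK].
have K0' : 0 < K%:R :> R by rewrite ltr0n.
have n0 : 0 < n%:R :> R by rewrite ltr0n ltnW.
have l0 : 0 < ln n%:R :> R by rewrite ln_gt0 // ltr1n.
have lK : ln n%:R <= 24 * K%:R :> R.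
  apply: le_trans (_ : ln ((2 ^ (24 * K))%:R) <= _).
    by rewrite ler_ln ?posrE // ?ltr0n ?expn_gt0 // ler_nat ltnW.
  rewrite natrX lnXn // -[_ *+ (_ * _)]mulr_natl natrM.
  have := ln2_le1; have := ltW K0'; nra.
have sn : 2 ^+ (12 * K.-1) <= Num.sqrt n%:R :> R.
  rewrite -[leLHS]ger0_norm ?exprn_ge0 // -sqrtr_sqr ler_wsqrtr //.
  by rewrite -exprM -natrX ler_nat (_ : 12 * K.-1 * 2 = 24 * K.-1)%N //; lia.
have -> : 2 ^+ (12 * K) = 2 ^+ 12 * 2 ^+ (12 * K.-1) :> R.
  by rewrite -exprD; congr (_ ^+ _); lia.
set c : R := 2 ^+ 12; have c0 : 0 < c by rewrite exprn_gt0.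
rewrite -[c * _ / _]mulrA [24 * c]mulrC -[c * 24 * _]mulrA ler_pM2l //.
rewrite [leRHS]mulrCA.
apply: ler_pM; [by rewrite exprn_ge0 | by rewrite invr_ge0 ltW | exact: sn | ].
by rewrite ler_pdivlMr // mulrC ler_pdivrMr.
Qed.

End Growth.

(** * Choice of parameters and constants *)

Local Open Scope ring_scope.

Theorem theorem8 (R : realType) :
  exists c1 c2 : R, [/\ 0 < c1, 0 < c2 &
    exists N : nat, forall n : nat, (N <= n)%N ->
      c1 * (n%:R `^ (3 / 4) / (ln n%:R) `^ (3 / 2))
        < (f_max 6 3 n)%:R - (prime_count n)%:R
        < c2 * (n%:R `^ (3 / 4) / (ln n%:R) `^ (3 / 2))].
Proof.
have [C C0 upper] := sidon_card_le R.
have p32 : 0 < pow32 (32 : R) by exact: pow32_gt0.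
have c0 : 0 < 24 * 2 ^+ 12 :> R by rewrite mulr_gt0 // exprn_gt0.
have pc : 0 < pow32 (24 * 2 ^+ 12 : R) by exact: pow32_gt0.
(* With [q = 2 ^+ l] below, the gain over [prime_count n] is at least [q ^+ 3 / 2], while
   [pow32 y <= pow32 32 * q ^+ 3]. Taking 4 instead of 2, and the [+ 1], make the inequalities
   strict. *)
exists (4 * pow32 32)^-1, (C * pow32 (24 * 2 ^+ 12) + 1); split.
- by rewrite invr_gt0 mulr_gt0.
- by rewrite addr_gt0 // mulr_gt0.
(* [48 <= t] gives [24 <= k] for the lower bound and [3 <= K] for the upper one. *)
have [N hN] := trunc_log_large 48.
exists N => n /hN[n0 tn]; set t := trunc_log 2 n in tn.
have /andP[t1 t2] : (2 ^ t <= n < 2 ^ t.+1)%N by apply: trunc_log_bounds.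
have n1 : (1 < n)%N by apply: leq_trans t1; rewrite -[2%N]expn1 leq_exp2l //; lia.
rewrite main_term ?ltr1n //; set y := Num.sqrt _ / _.
have y0 : 0 < y by rewrite divr_gt0 ?sqrtr_gt0 ?ln_gt0 ?ltr0n ?ltr1n.
have G0 := pow32_gt0 y0.
apply/andP; split.
  pose k := t./2.
  have k24 : (24 <= k)%N by rewrite /k; lia.
  have kn : (4 ^ k <= n < 4 ^ k.+1)%N.
    rewrite (_ : 4 = 2 ^ 2)%N // -!expnM; apply/andP; split.
      by apply: leq_trans t1; rewrite leq_exp2l // /k; lia.
    by apply: leq_trans t2 _; rewrite leq_exp2l // /k; lia.
  have k0 : (0 < k)%N by lia.
  pose P := prime_count (2 ^ k).
  have Pk : (2 ^ k.-1 <= k * P)%N by have := chebyshev_lower k.-1; rewrite prednK.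
  (* This makes [l >= 4], hence [q >= 16], so the at most [8 * q ^+ 2] primes given up cost no more
     than half of [q ^+ 3]. *)
  have P512 : (2 * 4 ^ 4 <= P)%N.
    rewrite (_ : 2 * 4 ^ 4 = 2 ^ 9)%N // leqNgt; apply/negP => P9.
    have : (k * P <= k * 2 ^ 9)%N by rewrite leq_mul2l ltnW ?orbT.
    have : (k * 2 ^ 9 < 2 ^ k.-1)%N.
      rewrite (_ : k.-1 = 9 + (4 + (k - 14)))%N; last by lia.
      rewrite expnD mulnC ltn_mul2l expn_gt0 /= expnD.
      have := ltn_expl (k - 14) (isT : 1 < 2)%N; lia.
    lia.
  (* The largest plane whose [2 * 4 ^ l] points and lines can be labelled by the [P] primes. *)
  pose l := trunc_log 4 (P %/ 2).
  have P2 : (0 < P %/ 2)%N by rewrite divn_gt0 //; lia.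
  have /andP[l1 l2] : (4 ^ l <= P %/ 2 < 4 ^ l.+1)%N by apply: trunc_log_bounds.
  have l4 : (4 <= l)%N by apply: trunc_log_max => //; rewrite leq_divRL // mulnC.
  have lP : (2 * 4 ^ l <= P)%N by rewrite mulnC -leq_divRL.
  have Pl : (P < 8 * 4 ^ l)%N by move: l2; rewrite ltn_divLR // expnS; lia.
  have l0 : (0 < l)%N by lia.
  have [k4 _] := andP kn.
  have := f_max_lower l0 lP k4.
  rewrite -/P -(ler_nat R) !natrD => low.
  (* By Chebyshev [2 ^ k.+1 <= 4 * (k * P)], and [P < 8 * 4 ^ l] gives the 32. *)
  have yl : y <= 32 * 4 ^+ l.
    apply: le_trans (sqrt_div_ln_le R k0 kn) _.
    rewrite ler_pdivrMr ?ltr0n // -exprS -!natrX -!natrM ler_nat.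
    rewrite -[k in (2 ^ k.+1)%N](prednK k0) !expnS.
    apply: leq_trans (_ : (2 * (2 * (k * P)) <= _)%N).
      by rewrite !leq_mul2l.
    have : (k * P <= k * (8 * 4 ^ l))%N by rewrite leq_mul2l ltnW ?orbT.
    lia.
  have e2 : 4 ^+ l = (2 ^+ l) ^+ 2 :> R.
    by rewrite [RHS]exprAC; congr (_ ^+ _); rewrite -natrX.
  have := pow32_le (ltW y0) yl; rewrite (@pow32M _ 32) // e2 pow32_sqr ?exprn_ge0 // => Gl.
  set q : R := 2 ^+ l in Gl.
  have q16 : 16 <= q.
    by rewrite (_ : 16 = 2 ^+ 4); [rewrite ler_eXn2l // ltr1n | rewrite -natrX].
  have e8 : (8 ^ l)%:R = q ^+ 3 :> R by rewrite natrX /q exprAC; congr (_ ^+ _); rewrite -natrX.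
  have e4 : (4 ^ l)%:R = q ^+ 2 :> R by rewrite natrX /q exprAC; congr (_ ^+ _); rewrite -natrX.
  have PR : P%:R <= 8 * q ^+ 2 :> R by rewrite -e4 -natrM ler_nat ltnW.
  rewrite e8 in low.
  have q0 : 0 < q ^+ 3 by rewrite exprn_gt0 // (lt_le_trans _ q16).
  have q3 : 16 * q ^+ 2 <= q ^+ 3 by rewrite [q ^+ 3]exprS ler_wpM2r // exprn_ge0 // (le_trans _ q16).
  rewrite mulrC ltr_pdivrMr ?mulr_gt0 //.
  apply: le_lt_trans Gl _.
  rewrite [ltRHS]mulrA [ltRHS]mulrC ltr_pM2l //.
  lra.
pose K := (t %/ 24).+1.
have Kn : (2 ^ (24 * K.-1) <= n < 2 ^ (24 * K))%N.
  apply/andP; split.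
    by apply: leq_trans t1; rewrite leq_exp2l // /K /=; lia.
  by apply: leq_trans t2 _; rewrite leq_exp2l // /K; lia.
have K3 : (3 <= K)%N by rewrite /K; lia.
have yK := @sqrt_div_ln_ge R K n (ltn_trans _ K3) n1 Kn.
have bound : C * (2 ^+ (18 * K) / (K%:R * Num.sqrt K%:R)) <= C * pow32 (24 * 2 ^+ 12) * pow32 y.
  rewrite -mulrA -pow32M ?(ltW c0) // ler_pM2l //.
  apply: le_trans (pow32_le _ (yK isT)); last by rewrite divr_ge0 ?exprn_ge0.
  rewrite pow32M ?exprn_ge0 // pow32V // (_ : 12 * K = 6 * K * 2)%N; last by lia.
  rewrite [2 ^+ (6 * K * 2)]exprM pow32_sqr ?exprn_ge0 // -exprM (_ : 6 * K * 3 = 18 * K)%N //; lia.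
have B : (f_max 6 3 n)%:R <= (prime_count n)%:R + C * (2 ^+ (18 * K) / (K%:R * Num.sqrt K%:R)).
  rewrite /f_max; elim/big_ind: _ => [|a b ha hb|A /asboolP trivA].
  - by rewrite addr_ge0 // mulr_ge0 ?(ltW C0) // divr_ge0 ?exprn_ge0 // mulr_ge0 // sqrtr_ge0.
  - by case: (leqP a b).
  - apply: upper => //; first exact: only_trivial_solutions_sidon.
    by case/andP: Kn => _ /ltnW.
by rewrite ltrBlDl mulrDl mul1r; lra.
Qed.
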